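(* There exists a universal constant $K<\infty$ such that, if $n\in\mathbb{N}$ and $h_{i,j}:S^2\to\mathbb{R}$, $i,j=1,\dots,n$, are bounded canonical kernels of two variables for the independent random variables $X_i^{(1)},X_j^{(2)}$, $i,j=1,\dots,n$, then $$E\Bigl|\sum_{1\le i,j\le n}h_{i,j}(X_i^{(1)},X_j^{(2)})\Bigr|^p\le K^p\Bigl[p^{p/2}\Bigl(\sum_{i,j}Eh_{i,j}^2\Bigr)^{p/2}+p^p\|(h_{i,j})\|_{L^2\to L^2}^p$$ $$+p^{3p/2}\Bigl(E_1\max_i\Bigl(\sum_jE_2h_{i,j}^2\Bigr)^{p/2}+E_2\max_j\Bigl(\sum_iE_1h_{i,j}^2\Bigr)^{p/2}\Bigr)+p^{2p}E\max_{i,j}|h_{i,j}|^p\Bigr]$$ for all $p\ge2$.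
   Context: The random variables $X_i^{(1)},X_j^{(2)}$, $1\le i,j\le n$, are all independent (not necessarily identically distributed) with values in a measurable space $(S,\mathcal{S})$; kernels are measurable. Inside expectations $h_{i,j}$ stands for $h_{i,j}(X_i^{(1)},X_j^{(2)})$. $E$ is expectation with respect to all variables, and $E_1$ (resp. $E_2$) is expectation only with respect to the variables $X_i^{(1)}$ (resp. $X_j^{(2)}$), the others being held fixed. The kernels are canonical (completely degenerate) if $E_1h_{i,j}(X_i^{(1)},X_j^{(2)})=0$ a.s. and $E_2h_{i,j}(X_i^{(1)},X_j^{(2)})=0$ a.s. for all $i,j$. The operator norm is $$\|(h_{i,j})\|_{L^2\to L^2}:=\sup\Bigl\{E\sum_{i,j}h_{i,j}(X_i^{(1)},X_j^{(2)})f_i(X_i^{(1)})g_j(X_j^{(2)}):\ E\sum_if_i^2(X_i^{(1)})\le1,\ E\sum_jg_j^2(X_j^{(2)})\le1\Bigr\},$$ the supremum being over measurable functions $f_i,g_j:S\to\mathbb{R}$. *)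

(* Defs.v *)
From HB Require Import structures.
From mathcomp Require Export all_boot all_order all_algebra.
From mathcomp Require Export all_classical all_reals all_analysis.
Export numFieldNormedType.Exports.

Set Implicit Arguments.
Unset Strict Implicit.
Unset Printing Implicit Defensive.

Import Order.TTheory GRing.Theory Num.Theory.
Local Open Scope classical_set_scope.
Local Open Scope ring_scope.

Definition mutually_independent {d d' : measure_display} {T : measurableType d}
    {S : measurableType d'} {R : realType} (P : probability T R) {I : finType}
    (X : I -> {RV P >-> S}) : Prop :=
  forall (J : {set I}) (A : I -> set S), (forall i, measurable (A i)) ->
    P (\bigcap_(i in [set` J]) (X i @^-1` A i)) =
    (\prod_(i in J) P (X i @^-1` A i))%E.

(* The families X1 and X2 concatenated: a single family of 2n variables. *)
Definition join_family {d d' : measure_display} {T : measurableType d}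
    {S : measurableType d'} {R : realType} {P : probability T R} {n : nat}
    (X1 X2 : 'I_n -> {RV P >-> S}) (k : 'I_n + 'I_n) : {RV P >-> S} :=
  match k with inl i => X1 i | inr j => X2 j end.

(* Expectation with respect to the variables of the family X only. Variables of
   another, independent family are held fixed when they occur in F as
   parameters; with X := X1 (resp. X2) this is E_1 (resp. E_2). *)
Definition partial_expectation {d d' : measure_display} {T : measurableType d}
    {S : measurableType d'} {R : realType} {P : probability T R} {n : nat}
    (X : 'I_n -> {RV P >-> S}) (F : ('I_n -> S) -> \bar R) : \bar R :=
  (\int[P]_w F (fun i => X i w))%E.

Definition canonical_kernels {d d' : measure_display} {T : measurableType d}
    {S : measurableType d'} {R : realType} {P : probability T R} {n : nat}
    (X1 X2 : 'I_n -> {RV P >-> S}) (h : 'I_n -> 'I_n -> S * S -> R) : Prop :=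
  forall i j : 'I_n,
    {ae P, forall w,
       partial_expectation X1 (fun x => (h i j (x i, X2 j w))%:E) = 0%E} /\
    {ae P, forall w,
       partial_expectation X2 (fun y => (h i j (X1 i w, y j))%:E) = 0%E}.

Definition opnorm {d d' : measure_display} {T : measurableType d}
    {S : measurableType d'} {R : realType} {P : probability T R} {n : nat}
    (X1 X2 : 'I_n -> {RV P >-> S}) (h : 'I_n -> 'I_n -> S * S -> R) : \bar R :=
  ereal_sup [set r : \bar R | exists f g : 'I_n -> S -> R,
    [/\ (forall i, measurable_fun setT (f i)) /\
        (forall j, measurable_fun setT (g j)),
        ('E_P[(fun w => \sum_(i < n) f i (X1 i w) ^+ 2)%R] <= 1)%E,
        ('E_P[(fun w => \sum_(j < n) g j (X2 j w) ^+ 2)%R] <= 1)%E &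
        r = ('E_P[(fun w => \sum_(i < n) \sum_(j < n)
               h i j (X1 i w, X2 j w) * f i (X1 i w) * g j (X2 j w))%R])%E]].

(* Main.v *)
From HB Require Import structures.
Require Import Defs.
From mathcomp Require Import measurable_realfun ring lra.
Set Implicit Arguments.
Unset Strict Implicit.
Unset Printing Implicit Defensive.

Import Order.TTheory GRing.Theory Num.Theory.
Local Open Scope classical_set_scope.
Local Open Scope ring_scope.

(* Write E_1, E_2 for the two partial expectations, [xi_i = sum_j E_2 h_ij^2] and
   [p = 2 r].

   1. Elementary Rosenthal inequality. For independent centered real [Z_j],
      [E |sum Z_j|^p <= K^p (p^(p/2) (sum E Z_j^2)^(p/2) + p^p sum E |Z_j|^p)]:
      add the variables one at a time, expand [|s + z|^p] to second order with
      error [(p + 1)^p |z|^p], and compare the resulting recursion for the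
      [p]-th moments with the [r]-th power of an affine function of the variances.

   2. Applied in the second variables it leaves [E_1 Q^r], where [Q] is the square
      of the norm of the Hilbert space valued sum [sum_i h_i(X_i)].  Averaging over
      splittings of the index set, [Q] is [sum_i xi_i] plus a mean of inner products
      of sums over complementary blocks.  Conditionally on one block such a product
      is a sum of independent centered real variables, whose variance is at most
      the squared operator norm times the [Q] of that block, so step 1 with
      exponent [r] bounds [E_1 Q^r] by its own square root and closes.

   3. The sums of [p]-th moments produced by 1 and 2 become moments of maxima
      through [sum E xi_i^q <= L^(1-q) (sum E xi_i)^q + (1 + L) E max xi_i^q] with
      [L = p^4], whose factors are at most exponential in [p]. *)

(** * Bounded measurable functions *)

(** Step 1 in the second variables also leaves [sum_j E |sum_i h_ij|^p]. A second use of step 1, in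
    the first variables, turns it into [sum_j E eta_j^r], with [eta_j = sum_i E_1 h_ij^2], and
    [sum_ij E |h_ij|^p]: the sources of the column maximum and of the entry maximum. Since only
    factors [K^p] may be lost, step 1 needs its powers of [p] exactly. A direct recursion cannot
    absorb the additive errors while the accumulated variance is small, so the affine function
    starts at [beta^(1/r)] for a free [beta > 0], chosen at the end comparable to the sum of the
    errors. The self-bounding in step 2 needs moments known to be finite. Boundedness of the kernels
    provides this: every integrand below is bounded and measurable, a class stable under sums,
    products, powers, maxima and partial integration, so expectations are real numbers that may be
    subtracted. *)

Definition bmf {d} {U : measurableType d} {R : realType} (f : U -> R) : Prop :=
  measurable_fun setT f /\ exists M : R, forall x, `|f x| <= M.

Section bmf_theory.
Context {d} {U : measurableType d} {R : realType}.
Implicit Types f g : U -> R.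

Lemma bmf_cst (c : R) : bmf (fun _ : U => c).
Proof. by split; [exact: measurable_cst|exists `|c|]. Qed.

Lemma bmfD f g : bmf f -> bmf g -> bmf (fun x => f x + g x).
Proof.
move=> [mf [M fM]] [mg [N gN]]; split; first exact: measurable_funD.
by exists (M + N) => x; rewrite (le_trans (ler_normD _ _))// lerD.
Qed.

Lemma bmfM f g : bmf f -> bmf g -> bmf (fun x => f x * g x).
Proof.
move=> [mf [M fM]] [mg [N gN]]; split; first exact: measurable_funM.
by exists (M * N) => x; rewrite normrM ler_pM.
Qed.

Lemma bmfN f : bmf f -> bmf (fun x => - f x).
Proof.
move=> [mf [M fM]]; split; first exact: measurable_funN.
by exists M => x; rewrite normrN.
Qed.

Lemma bmfX f k : bmf f -> bmf (fun x => f x ^+ k).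
Proof.
move=> [mf [M fM]]; split; first exact: measurable_funX.
by exists (M ^+ k) => x; rewrite normrX lerXn2r// nnegrE// (le_trans _ (fM x)).
Qed.

Lemma bmf_norm f : bmf f -> bmf (fun x => `|f x|).
Proof.
move=> [mf [M fM]]; split; first exact: measurableT_comp.
by exists M => x; rewrite normr_id.
Qed.

Lemma bmf_powR f p : 0 <= p -> bmf f -> bmf (fun x => f x `^ p).
Proof.
move=> p0 [mf [M fM]]; split.
  exact: (measurableT_comp (measurable_powR p) mf).
(* A negative base has power 1 by convention, hence the summand 1. *)
exists (1 + M `^ p) => x; rewrite ger0_norm ?powR_ge0//.
have [fx|fx] := ltP (f x) 0.
  by rewrite lt0_powR1// lerDl powR_ge0.
rewrite (@le_trans _ _ (M `^ p)) ?lerDr// ge0_ler_powR ?nnegrE//.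
  exact: le_trans (fM x).
exact: le_trans (ler_norm _) (fM x).
Qed.

Lemma bmf_max f g : bmf f -> bmf g -> bmf (fun x => Num.max (f x) (g x)).
Proof.
move=> [mf [M fM]] [mg [N gN]]; split; first exact: measurable_maxr.
exists (M + N) => x; have [_|_] := leP (f x) (g x).
  by rewrite (le_trans (gN x))// lerDr (le_trans _ (fM x)).
by rewrite (le_trans (fM x))// lerDl (le_trans _ (gN x)).
Qed.

Lemma bmf_sum {I : Type} (s : seq I) (Q : pred I) (f : I -> U -> R) :
  (forall i, bmf (f i)) -> bmf (fun x => \sum_(i <- s | Q i) f i x).
Proof.
move=> bf; elim: s => [|i s IH].
  by under eq_fun do rewrite big_nil; exact: bmf_cst.
under eq_fun do rewrite big_cons; case: (Q i) => //; exact: bmfD.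
Qed.

Lemma bmf_bigmax {I : Type} (s : seq I) (Q : pred I) (f : I -> U -> R) :
  (forall i, bmf (f i)) -> bmf (fun x => \big[Num.max/0]_(i <- s | Q i) f i x).
Proof.
move=> bf; elim: s => [|i s IH].
  by under eq_fun do rewrite big_nil; exact: bmf_cst.
under eq_fun do rewrite big_cons; case: (Q i) => //; exact: bmf_max.
Qed.

Lemma bmf_comp {d'} {V : measurableType d'} (h : V -> R) (g : U -> V) :
  measurable_fun setT g -> bmf h -> bmf (fun x => h (g x)).
Proof.
move=> mg [mh [M hM]]; split; first exact: measurableT_comp mh mg.
by exists M.
Qed.

End bmf_theory.

Section expectation_bmf.
Context {d} {T : measurableType d} {R : realType} (P : probability T R).
Implicit Types f g : T -> R.

Lemma bmf_integrable f : bmf f -> P.-integrable setT (EFin \o f).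
Proof.
move=> [mf [M fM]]; apply: measurable_bounded_integrable => //.
  by rewrite (le_lt_trans (probability_le1 _ _)) ?ltry.
exists M; split; first by rewrite num_real.
by move=> N MN x _ /=; exact: le_trans (fM x) (ltW MN).
Qed.

Lemma EFin_Rintegral f : bmf f ->
  (\int[P]_w (f w)%:E = (\int[P]_w f w)%R%:E)%E.
Proof.
move=> bf; rewrite /Rintegral fineK//.
exact/integrable_fin_num/bmf_integrable.
Qed.

Lemma ExD f g : bmf f -> bmf g ->
  \int[P]_w (f w + g w) = \int[P]_w f w + \int[P]_w g w.
Proof. by move=> bf bg; rewrite RintegralD//; exact: bmf_integrable. Qed.

Lemma ExZ c f : bmf f -> \int[P]_w (c * f w) = c * \int[P]_w f w.
Proof. by move=> bf; rewrite RintegralZl//; exact: bmf_integrable. Qed.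

Lemma ExZr c f : bmf f -> \int[P]_w (f w * c) = \int[P]_w f w * c.
Proof. by move=> bf; rewrite RintegralZr//; exact: bmf_integrable. Qed.

Lemma Ex_cst (c : R) : \int[P]_w c = c.
Proof. by rewrite Rintegral_cst// [X in fine X]probability_setT mulr1. Qed.

Lemma ExN f : bmf f -> \int[P]_w (- f w) = - \int[P]_w f w.
Proof.
by move=> bf; under eq_Rintegral do rewrite -mulN1r; rewrite ExZ// mulN1r.
Qed.

Lemma le_Ex f g : bmf f -> bmf g -> (forall w, f w <= g w) ->
  \int[P]_w f w <= \int[P]_w g w.
Proof. by move=> bf bg fg; apply: le_Rintegral => //; exact: bmf_integrable. Qed.

Lemma Ex_sum {I : Type} (s : seq I) (Q : pred I) (f : I -> T -> R) :
  (forall i, bmf (f i)) ->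
  \int[P]_w (\sum_(i <- s | Q i) f i w) = \sum_(i <- s | Q i) \int[P]_w f i w.
Proof.
move=> bf; elim: s => [|i s IH].
  by rewrite big_nil; under eq_Rintegral do rewrite big_nil; rewrite Ex_cst.
rewrite big_cons; under eq_Rintegral do rewrite big_cons.
case: (Q i) => //; rewrite ExD ?IH//; exact: bmf_sum.
Qed.

End expectation_bmf.

Section fubini_bmf.
Context {d1 d2} {T1 : measurableType d1} {T2 : measurableType d2} {R : realType}.
Variables (P1 : probability T1 R) (P2 : probability T2 R).
Implicit Type f : T1 * T2 -> R.

Lemma bmf_pair1 f x : bmf f -> bmf (fun y => f (x, y)).
Proof. by apply: bmf_comp; exact: measurable_pair1. Qed.

Lemma le_normr_Ex (g : T2 -> R) M : bmf g -> (forall y, `|g y| <= M) ->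
  `|\int[P2]_y g y| <= M.
Proof.
move=> bg gM; rewrite (le_trans (le_normr_Rintegral _ _))//.
  exact: bmf_integrable.
by rewrite -[leRHS](Ex_cst P2); apply: le_Ex => //;
  [exact: bmf_norm|exact: bmf_cst].
Qed.

Lemma bmf_Ex1 f : bmf f -> bmf (fun x => \int[P2]_y f (x, y)).
Proof.
move=> bf; have [mf [M fM]] := bf; split; last first.
  by exists M => x; apply: le_normr_Ex => //; exact: bmf_pair1.
have : measurable_fun setT (fubini_F P2 (EFin \o f)).
  apply: (measurable_fubini_F (m1 := P1)).
  exact: (bmf_integrable (P1 \x P2)%E).
by move=> /(measurableT_comp (fine_measurable measurableT)); apply: eq_measurable_fun.
Qed.

Lemma EFin_Ex_prod f : bmf f ->
  (\int[P1]_x \int[P2]_y (f (x, y))%:E =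
   (\int[P1]_x \int[P2]_y f (x, y))%R%:E)%E.
Proof.
move=> bf; rewrite -EFin_Rintegral; last exact: bmf_Ex1.
by apply: eq_integral => x _; rewrite EFin_Rintegral//; exact: bmf_pair1.
Qed.

End fubini_bmf.

Lemma bmf_Ex {d1 d2} {T1 : measurableType d1} {T2 : measurableType d2}
    {R : realType} (P2 : probability T2 R) (F : T1 -> T2 -> R) :
  bmf (fun z : T1 * T2 => F z.1 z.2) -> bmf (fun x => \int[P2]_y F x y).
(* The Fubini measurability lemma wants a measure on the first factor as well; a Dirac mass
   serves. *)
Proof. by move=> bF; apply: (@bmf_Ex1 _ _ _ _ _ \d_point P2 _ bF). Qed.

Lemma Ex_swap {d1 d2} {T1 : measurableType d1} {T2 : measurableType d2}
    {R : realType} (P1 : probability T1 R) (P2 : probability T2 R)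
    (F : T1 -> T2 -> R) :
  bmf (fun z : T1 * T2 => F z.1 z.2) ->
  \int[P1]_x \int[P2]_y F x y = \int[P2]_y \int[P1]_x F x y.
Proof.
move=> bF; apply: EFin_inj.
have bF' : bmf (fun z : T2 * T1 => F z.2 z.1).
  have := bmf_comp (@measurable_swap _ _ T2 T1) bF; exact.
rewrite -(EFin_Ex_prod P1 P2 bF) -(EFin_Ex_prod P2 P1 bF').
apply: (@Fubini _ _ _ _ _ P1 P2 (fun z => (F z.1 z.2)%:E)).
exact: (bmf_integrable (P1 \x P2)%E).
Qed.

Ltac bmf_tac := repeat first
  [ assumption | solve [eauto] | apply: bmf_cst | apply: bmfD | apply: bmfN
  | apply: bmfM | apply: bmfX | apply: bmf_norm | apply: bmf_powR
  | apply: bmf_max | (apply: bmf_sum => ?) | (apply: bmf_bigmax => ?)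
  | apply: bmf_Ex ].

(** * Independence as resampling *)

(** Measurable boxes: a pi-system generating the product sigma-algebra, so that a whole family of
    variables has one law, determined by its values on boxes. *)
Definition rect {d} (S : measurableType d) (I : finType) : set (set (I -> S)) :=
  [set B | exists2 A : I -> set S, (forall i, measurable (A i)) &
     B = [set x | forall i, A i (x i)]].

Arguments rect {d} S I.

Notation fam I S := (g_sigma_algebraType (rect S I)).

Definition mix {I : finType} {S : Type} (A : {set I}) (x y : I -> S) : I -> S :=
  fun i => if i \in A then x i else y i.

Section fam_measurable.
Context {d} {S : measurableType d} {I : finType}.

Lemma measurable_coord (i : I) : measurable_fun setT (fun x : fam I S => x i).
Proof.
move=> _ Y mY; rewrite setTI; apply: sub_sigma_algebra.
exists (fun j => if j == i then Y else setT) => [j|]; first by case: ifP.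
apply/seteqP; split=> [x /= Yxi j|x /= /(_ i)]; last by rewrite eqxx.
by case: eqVneq => // ->.
Qed.

Lemma measurable_fam {d'} {U : measurableType d'} (g : U -> fam I S) :
  (forall i, measurable_fun setT (fun u => g u i)) -> measurable_fun setT g.
Proof.
move=> mg; apply: (@measurability _ _ U (fam I S) setT g (rect S I)) => //.
move=> _ [_ [A mA ->] <-]; rewrite setTI.
have -> : g @^-1` [set x | forall i, A i (x i)] =
    \bigcap_(i in [set: I]) ((fun u => g u i) @^-1` A i).
  by apply/seteqP; split=> [u /= gA i _|u /= gA i]; apply: gA.
apply: fin_bigcap_measurable => // i _.
by rewrite -[X in measurable X]setTI; exact: mg.
Qed.

End fam_measurable.

Section resample.
Context {d d'} {T : measurableType d} {S : measurableType d'} {R : realType}.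
Context {P : probability T R} {I : finType} (X : I -> {RV P >-> S}).
Hypothesis indX : mutually_independent X.

Definition joint (w : T) : fam I S := fun i => X i w.
Definition joint_mix (A : {set I}) (z : T * T) : fam I S :=
  mix A (X ^~ z.1) (X ^~ z.2).

Lemma measurable_joint : measurable_fun setT joint.
Proof. by apply: measurable_fam => i; exact: measurable_funP. Qed.

Lemma measurable_joint_mix A : measurable_fun setT (joint_mix A).
Proof.
apply: measurable_fam => i; rewrite /joint_mix /mix; case: (i \in A).
  exact: measurableT_comp (measurable_funP (X i)) measurable_fst.
exact: measurableT_comp (measurable_funP (X i)) measurable_snd.
Qed.

HB.instance Definition _ :=
  isMeasurableFun.Build _ _ _ _ joint measurable_joint.

HB.instance Definition _ A :=
  isMeasurableFun.Build _ _ _ _ (joint_mix A) (measurable_joint_mix A).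

(** On a box both sides are the product of the marginal probabilities: independence is used on all
    of [I] for the left side, and on [A] and its complement for the right. Boxes are stable under
    intersection, so the two laws coincide. *)
Let law_mix A (B : set (fam I S)) : measurable B ->
  distribution P joint B = distribution (P \x P)%E (joint_mix A) B.
Proof.
move=> mB.
apply: (@measure_unique _ R (fam I S) (rect S I) (fun=> setT) erefl _ _ _
  (distribution P joint) (distribution (P \x P)%E (joint_mix A)) _ _ B mB).
- move=> _ _ [A1 mA1 ->] [A2 mA2 ->].
  exists (fun i => A1 i `&` A2 i) => [i|]; first exact: measurableI.
  apply/seteqP; split=> [x /= [h1 h2] i|x /= h]; first by split.
  by split=> i; case: (h i).
- by move=> _; exists (fun=> setT) => //; apply/seteqP; split.
- by rewrite bigcup_const.
- move=> _ [D mD ->].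
  have mXD i : measurable (X i @^-1` D i).
    by rewrite -[X in measurable X]setTI; exact: measurable_funP.
  have mcap (J : {set I}) :
      measurable (\bigcap_(i in [set` J]) (X i @^-1` D i)).
    by apply: fin_bigcap_measurable => //.
  rewrite /= /distribution /pushforward.
  have -> : joint @^-1` [set x | forall i, D i (x i)] =
      \bigcap_(i in [set` [set: I]%SET]) (X i @^-1` D i).
    apply/seteqP; split=> [w /= h i _|w /= h i]; first exact: h.
    by apply: (h i); rewrite /= inE.
  have -> : joint_mix A @^-1` [set x | forall i, D i (x i)] =
      (\bigcap_(i in [set` A]) (X i @^-1` D i)) `*`
      (\bigcap_(i in [set` (~: A)%SET]) (X i @^-1` D i)).
    apply/seteqP; split=> [z /= h|z /= [h1 h2] i].
      split=> i /= iA; move: (h i); rewrite /joint_mix /mix ?iA//.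
      by move: iA; rewrite inE => /negbTE ->.
    rewrite /joint_mix /mix; case: ifPn => iA; first exact: h1.
    by apply: h2; rewrite /= inE.
  rewrite product_measure1E// (indX [set: I]%SET mD).
  transitivity ((\prod_(i in A) P (X i @^-1` D i)) *
                (\prod_(i in ~: A) P (X i @^-1` D i)))%E.
    rewrite (bigID (mem A))/=.
    by congr (_ * _)%E; apply: eq_bigl => i; rewrite !inE ?andbT.
  by congr (_ * _)%E; apply/esym; exact: indX.
- by move=> _; rewrite /= /distribution /pushforward preimage_setT probability_setT ltry.
Qed.

(** The form in which independence is used from here on: conditioning on the coordinates in [A]
    becomes an iterated integral against [P] itself. *)
Lemma resample (A : {set I}) (G : fam I S -> R) : bmf G ->
  \int[P]_w G (fun i => X i w) =
  \int[P]_w \int[P]_w' G (mix A (X ^~ w) (X ^~ w')).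
Proof.
move=> bG; have [mG _] := bG.
have bGA : bmf (fun z : T * T => G (mix A (X ^~ z.1) (X ^~ z.2))).
  exact: bmf_comp (measurable_joint_mix A) bG.
have bGX : bmf (fun w => G (fun i => X i w)).
  exact: bmf_comp measurable_joint bG.
apply: EFin_inj; rewrite -(EFin_Ex_prod P P bGA) -EFin_Rintegral//.
rewrite (integral12_prod_meas1 (bmf_integrable (P \x P)%E bGA)).
have mEG : measurable_fun setT (EFin \o G) by exact/measurable_EFinP.
transitivity (\int[distribution P joint]_x (EFin \o G) x)%E.
  by rewrite integral_distribution//; exact: bmf_integrable.
transitivity (\int[distribution (P \x P)%E (joint_mix A)]_x (EFin \o G) x)%E.
  by apply: eq_measure_integral => B mB _; exact: law_mix.
by rewrite integral_distribution//; exact: bmf_integrable.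
Qed.

End resample.

(** * Inequalities for real powers *)

Section powR_inequalities.
Context {R : realType}.
Implicit Types a b c m p r s u x y z : R.

(** Young's inequality for [y] and [a^(r - 1)] with the conjugate exponents [r] and [r / (r - 1)];
    at [r = 1] the second exponent is infinite and the claim is an equality. *)
Lemma powR_tangent r a y : 1 <= r -> 0 <= a -> 0 <= y ->
  a `^ r + r * a `^ (r - 1) * (y - a) <= y `^ r.
Proof.
move=> r1 a0 y0; have r0 : 0 < r by lra.
have [->|rN1] := eqVneq r 1.
  by rewrite !powRr1// subrr powRr0 mul1r mul1r addrC subrK.
have {}r1 : 0 < r - 1 by rewrite subr_gt0 lt_neqAle eq_sym rN1.
have q0 : 0 < r / (r - 1) by rewrite divr_gt0.
have pq : r^-1 + (r / (r - 1))^-1 = 1 by rewrite invf_div; field; lra.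
have := conjugate_powR y0 (powR_ge0 a (r - 1)) r0 q0 pq.
rewrite -powRrM [(r - 1) * _]mulrC divfK ?gt_eqF//.
have <- := mulr_powRB1 a0 r0; set t := a `^ (r - 1) => h.
have : r * (y * t) <= r * (y `^ r / r + a * t / (r / (r - 1))).
  by rewrite ler_pM2l.
have -> : r * (y `^ r / r + a * t / (r / (r - 1))) = y `^ r + (r - 1) * (a * t).
  by field; lra.
lra.
Qed.

Lemma powRX a p k : 0 <= a -> (a ^+ k) `^ p = (a `^ p) ^+ k.
Proof.
by move=> a0; rewrite -(powR_mulrn k a0) -(powR_mulrn k (powR_ge0 a p)) powRAC.
Qed.

Lemma powR_sum2 r x y : 0 <= r -> 0 <= x -> 0 <= y ->
  (x + y) `^ r <= 2 `^ r * (x `^ r + y `^ r).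
Proof.
move=> r0; wlog xy : x y / x <= y => [H x0 y0|x0 y0].
  have [xy|/ltW yx] := leP x y; first exact: H.
  by rewrite addrC [X in _ * X]addrC; exact: H.
rewrite (@le_trans _ _ ((2 * y) `^ r))//.
  by apply: ge0_ler_powR; rewrite ?nnegrE; lra.
by rewrite powRM ?ler0n// ler_wpM2l ?powR_ge0// lerDr powR_ge0.
Qed.

Lemma powR_mean (I : finType) (f : I -> R) r : 1 <= r -> (forall i, 0 <= f i) ->
  (#|I|%:R^-1 * \sum_i f i) `^ r <= #|I|%:R^-1 * \sum_i f i `^ r.
Proof.
move=> r1 f0; have [I0|I0] := posnP #|I|.
  by rewrite I0 invr0 !mul0r powR0//; lra.
have N0 : 0 < #|I|%:R :> R by rewrite ltr0n.
set a := #|I|%:R^-1 * _; have a0 : 0 <= a.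
  by rewrite mulr_ge0 ?invr_ge0 ?ler0n ?sumr_ge0.
rewrite ler_pdivlMl//.
apply: le_trans (_ : \sum_i (a `^ r + r * a `^ (r - 1) * (f i - a)) <= _);
  last by apply: ler_sum => i _; exact: powR_tangent.
rewrite big_split/= -mulr_sumr big_split/= sumr_const sumrN sumr_const.
have -> : \sum_i f i = #|I|%:R * a by rewrite mulrA divff ?gt_eqF// mul1r.
by rewrite -[a *+ _]mulr_natl subrr mulr0 addr0 mulr_natl.
Qed.

(** Inverting [1 - x <= expR (- x)] gives [expR x <= 1 / (1 - x)], enough for negative [x]. As this
    blows up at 1, positive [x] are treated by the same bound at [x / 2], squared. *)
Lemma expR_quadratic_bound x : `|x| <= 1 -> expR x <= 1 + x + 3 * x ^+ 2.
Proof.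
move=> x1; have [x0|x0] := leP 0 x; last first.
  have h := expR_ge1Dx (- x); rewrite expRN in h.
  have e0 := expR_gt0 x.
  have : expR x * (1 - x) <= 1.
    rewrite -[leRHS](@divff _ (expR x)) ?gt_eqF// ler_pM2l//.
  move=> h1; have x2 : 0 < 1 - x by lra.
  rewrite -(ler_pM2r x2) (le_trans h1)//.
  have := sqr_ge0 x; have : 0 <= x ^+ 2 * - x by rewrite mulr_ge0 ?sqr_ge0; lra.
  lra.
have h := expR_ge1Dx (- (x / 2)).
have {}x1 : x <= 1 by rewrite -(ger0_norm x0).
have e0 := expR_gt0 (x / 2).
have eE : expR x = expR (x / 2) ^+ 2.
  by rewrite expr2 -expRD; congr expR; field.
have : expR (x / 2) * (1 - x / 2) <= 1.
  rewrite -[leRHS](@divff _ (expR (x / 2))) ?gt_eqF// ler_pM2l//.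
  by rewrite -expRN.
rewrite eE; set e := expR _; move=> he.
have h1 : (e * (1 - x / 2)) ^+ 2 <= 1 by rewrite expr_le1// mulr_ge0 ?(ltW e0)//; lra.
have h2 : 1 <= (1 + x + 3 * x ^+ 2) * (1 - x / 2) ^+ 2 by nra.
have h3 : 0 < (1 - x / 2) ^+ 2 by rewrite exprn_gt0//; lra.
by rewrite -(ler_pM2r h3) -exprMn (le_trans h1).
Qed.

(** Passing through [expR (p * u)] keeps the constant in front of [(p * u) ^+ 2] free of [p]. *)
Lemma powR_1D_le p u : 1 <= p -> `|p * u| <= 1 ->
  (1 + u) `^ p <= 1 + p * u + 3 * (p * u) ^+ 2.
Proof.
move=> p1 pu; apply: le_trans (expR_quadratic_bound pu).
have u0 : 0 <= 1 + u.
  have : `|u| <= 1.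
    by apply: le_trans pu; rewrite normrM ger0_norm ?ler_peMl//; lra.
  by rewrite ler_norml; lra.
have -> : expR (p * u) = expR u `^ p.
  by rewrite /powR gt_eqF ?expR_gt0// expRK.
by apply: ge0_ler_powR; rewrite ?nnegrE ?expR_ge0 ?expR_ge1Dx//; lra.
Qed.

Lemma powR_norm_sqr p s : 2 <= p -> `|s| `^ p = s ^+ 2 * `|s| `^ (p - 2).
Proof.
move=> p2; have [->|s0] := eqVneq s 0.
  by rewrite expr0n/= mul0r normr0 powR0//; lra.
rewrite -[s ^+ 2]real_normK ?num_real// -powR_mulrn// -powRD.
  by congr powR; ring.
by rewrite normr_eq0 s0 implybT.
Qed.

(** The cases split at [|p z| = |s|]. If [|p z|] is smaller, [z / s] is in the range of
    [powR_1D_le]. If it is larger, [|s + z| <= (p + 1) |z|], whence the factor [(p + 1)^p]; the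
    remaining terms are then [|s|^(p - 2)] times a nonnegative quadratic form in [s] and [p z]. *)
Lemma powR_normD_le p s z : 2 <= p ->
  `|s + z| `^ p <= `|s| `^ p + p * (z * (s * `|s| `^ (p - 2))) +
     3 * p ^+ 2 * (z ^+ 2 * `|s| `^ (p - 2)) + (p + 1) `^ p * `|z| `^ p.
Proof.
move=> p2; rewrite (powR_norm_sqr s)//; set t := `|s| `^ (p - 2).
have t0 : 0 <= t by exact: powR_ge0.
have z0 : 0 <= (p + 1) `^ p * `|z| `^ p by rewrite mulr_ge0 ?powR_ge0.
have [pz|pz] := leP `|p * z| `|s|; last first.
  rewrite ler_wpDl//.
    have : 0 <= t * (s ^+ 2 + p * z * s + 3 * (p * z) ^+ 2).
      by rewrite mulr_ge0//; nra.
    lra.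
  rewrite -powRM//; last by lra.
  apply: ge0_ler_powR; rewrite ?nnegrE ?mulr_ge0//; try lra.
  move: pz; rewrite normrM ger0_norm; last by lra.
  have := ler_normD s z; lra.
have [s0|s0] := eqVneq s 0.
  move: pz; rewrite s0 normr0 normr_le0 mulf_eq0 => /orP[/eqP|/eqP->].
    by lra.
  by rewrite addr0 normr0 !(mul0r, mulr0, expr0n, addr0)/= powR0 ?mulr0//; lra.
rewrite ler_wpDr//.
have sz : s + z = s * (1 + z / s) by field.
rewrite sz normrM powRM// (powR_norm_sqr s)// -/t.
have pu : `|p * (z / s)| <= 1.
  by rewrite mulrA normrM normfV ler_pdivrMr ?normr_gt0// mul1r.
have p1 : 1 <= p by lra.
have := powR_1D_le p1 pu.
have -> : `|1 + z / s| = 1 + z / s.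
  rewrite ger0_norm//; move: pu; rewrite normrM (ger0_norm (_ : 0 <= p)); last by lra.
  have := ler_norm (- (z / s)); rewrite normrN.
  by have := normr_ge0 (z / s); nra.
have st : 0 <= s ^+ 2 * t by rewrite mulr_ge0 ?sqr_ge0.
move=> /(ler_wpM2l st) /le_trans; apply; rewrite le_eqVlt; apply/orP; left.
by apply/eqP; field.
Qed.

(** For nonnegative increments first order is enough: with [v = r x / s] in [0, 1], the quadratic
    term [3 v^2] is at most [3 v], so the slope is [1 + 3 = 4]. *)
Lemma powR_addr_le r s x : 1 <= r -> 0 <= s -> 0 <= x ->
  (s + x) `^ r <= s `^ r + 4 * r * (x * s `^ (r - 1)) + (r + 1) `^ r * x `^ r.
Proof.
move=> r1 s0 x0.
have t0 : 0 <= s `^ r by exact: powR_ge0.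
have t1 : 0 <= s `^ (r - 1) by exact: powR_ge0.
have z0 : 0 <= (r + 1) `^ r * x `^ r by rewrite mulr_ge0 ?powR_ge0.
have [rx|rx] := leP (r * x) s; last first.
  rewrite ler_wpDl//.
    by rewrite addr_ge0// mulr_ge0 ?mulr_ge0//; lra.
  rewrite -powRM//; last by lra.
  by apply: ge0_ler_powR; rewrite ?nnegrE ?mulr_ge0//; lra.
have [s00|sN0] := eqVneq s 0.
  move: rx; rewrite s00 => rx; have -> : x = 0 by nra.
  by rewrite addr0 mul0r mulr0 addr0 lerDl mulr_ge0 ?powR_ge0.
have {}s0 : 0 < s by rewrite lt_neqAle eq_sym sN0.
rewrite ler_wpDr//.
have sz : s + x = s * (1 + x / s) by field.
have u0 : 0 <= x / s by rewrite divr_ge0// ltW.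
rewrite sz powRM ?(ltW s0)//; last by lra.
have pu : `|r * (x / s)| <= 1.
  have ru0 : 0 <= r * (x / s) by apply: mulr_ge0 => //; lra.
  by rewrite ger0_norm// mulrA ler_pdivrMr// mul1r.
have := powR_1D_le r1 pu.
move=> /(ler_wpM2l t0) /le_trans; apply.
have -> : s `^ r + 4 * r * (x * s `^ (r - 1)) = s `^ r * (1 + 4 * (r * (x / s))).
  by rewrite -(mulr_powRB1 (ltW s0))//; [field|lra].
rewrite ler_wpM2l//.
move: pu; set v := r * _; have : 0 <= v by rewrite mulr_ge0//; lra.
by rewrite ler_norml; nra.
Qed.

(* [K] absorbs the additive errors: it grows by [b / beta] at each step, and
   [beta <= x `^ r] keeps [b <= (b / beta) * x `^ r]. *)
Lemma powR_recursion_step r K x m c u b beta u' : 1 <= r -> 1 <= K -> 0 <= m ->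
    0 <= c -> 0 <= b -> 0 <= u -> 0 < beta -> beta `^ r^-1 <= x ->
    u <= K * x `^ r ->
    u' <= u + c * r * (m * u `^ ((r - 1) / r)) + b ->
  u' <= (K + b / beta) * (x + c * m) `^ r.
Proof.
move=> r1 K1 m0 c0 b0 u0 beta0 betax uK /le_trans; apply.
have r0 : 0 < r by lra.
have x0 : 0 <= x by rewrite (le_trans _ betax)// powR_ge0.
have cm0 : 0 <= c * m by rewrite mulr_ge0.
have h1 : u `^ ((r - 1) / r) <= K * x `^ (r - 1).
  apply: le_trans (_ : (K * x `^ r) `^ ((r - 1) / r) <= _).
    apply: ge0_ler_powR; rewrite ?nnegrE ?divr_ge0 ?mulr_ge0 ?powR_ge0//; lra.
  rewrite powRM ?powR_ge0//; last by lra.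
  rewrite -powRrM [r * _]mulrC divfK ?gt_eqF// ler_wpM2r ?powR_ge0//.
  by apply: ler1_powR => //; rewrite ler_pdivrMr// mul1r; lra.
(* [r x^(r - 1) (c m)] is the linear term of the [r]-th power at [x], so the tangent inequality
   absorbs the middle term of the recursion. *)
have h2 := powR_tangent r1 x0 (addr_ge0 x0 cm0).
have h3 : b <= b / beta * (x + c * m) `^ r.
  rewrite mulrAC ler_pdivlMr// ler_wpM2l//.
  have -> : beta = (beta `^ r^-1) `^ r by rewrite -powRrM mulVf ?gt_eqF// powRr1// ltW.
  by apply: ge0_ler_powR; rewrite ?nnegrE ?powR_ge0//; lra.
rewrite [(K + _) * _]mulrDl lerD//.
apply: le_trans (_ : K * (x `^ r + r * x `^ (r - 1) * (x + c * m - x)) <= _);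
  last by rewrite ler_wpM2l//; lra.
have : c * r * (m * u `^ ((r - 1) / r)) <= c * r * (m * (K * x `^ (r - 1))).
  by rewrite !ler_wpM2l// mulr_ge0// ltW.
lra.
Qed.

End powR_inequalities.

Lemma jensen_powR {d} {T : measurableType d} {R : realType}
    (P : probability T R) (Y : T -> R) (r : R) : 1 <= r -> bmf Y ->
    (forall w, 0 <= Y w) ->
  (\int[P]_w Y w) `^ r <= \int[P]_w (Y w `^ r).
Proof.
move=> r1 bY Y0; set a := \int[P]_w Y w.
have a0 : 0 <= a by apply: Rintegral_ge0.
have r0 : 0 <= r by lra.
apply: le_trans (_ : \int[P]_w (a `^ r + r * a `^ (r - 1) * (Y w - a)) <= _).
  rewrite ExD; [|bmf_tac..]; rewrite ExZ; last by bmf_tac.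
  rewrite ExD; [|bmf_tac..]; rewrite !Ex_cst -/a.
  by rewrite subrr mulr0 addr0.
by apply: le_Ex => [||w]; [bmf_tac..|exact: powR_tangent].
Qed.

Lemma Ex_powR_le {d} {T : measurableType d} {R : realType}
    (P : probability T R) (V : T -> R) (t : R) : 0 <= t <= 1 -> bmf V ->
    (forall w, 0 <= V w) ->
  \int[P]_w (V w `^ t) <= (\int[P]_w V w) `^ t.
Proof.
move=> /andP[t0 t1] bV V0; have [->|tN0] := eqVneq t 0.
  rewrite powRr0; under eq_Rintegral do rewrite powRr0.
  by rewrite Ex_cst.
have {}t0 : 0 < t by rewrite lt_neqAle eq_sym tN0.
have e0 : 0 <= \int[P]_w (V w `^ t).
  by apply: Rintegral_ge0 => w _; exact: powR_ge0.
rewrite -[leLHS](powRr1 e0) -[X in _ `^ X](mulVf tN0) powRrM.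
apply: ge0_ler_powR; rewrite ?nnegrE ?powR_ge0 ?(ltW t0)//.
  by apply: Rintegral_ge0.
have tV1 : 1 <= t^-1 by rewrite invf_ge1.
have bVt : bmf (fun w => V w `^ t) by apply: bmf_powR => //; exact: ltW.
apply: le_trans (jensen_powR P tV1 bVt (fun w => powR_ge0 _ _)) _.
apply: le_Ex => //; first by apply: bmf_powR; rewrite ?invr_ge0 ?ltW.
by move=> w; rewrite -powRrM divff// powRr1.
Qed.

(** The choice [beta = B] makes the first factor 2, and [powR_sum2] splits the second. As [B] may
    vanish, [beta] is taken to be [B + e / C] with [e > 0] arbitrary. *)
Lemma powR_absorb {R : realType} (r B M u : R) : 1 <= r -> 0 <= B -> 0 <= M ->
    (forall beta : R, 0 < beta ->
       u <= (1 + B / beta) * (beta `^ r^-1 + M) `^ r) ->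
  u <= 2 * 2 `^ r * (B + M `^ r).
Proof.
move=> r1 B0 M0 H; have r0 : 0 < r by lra.
set C := 2 * 2 `^ r; have C0 : 0 < C by rewrite mulr_gt0// powR_gt0.
apply/ler_addgt0Pr => e e0.
have beta0 : 0 < B + e / C by rewrite ltr_wpDl// divr_gt0.
apply: le_trans (H _ beta0) _.
have h1 : 1 + B / (B + e / C) <= 2.
  have : B / (B + e / C) <= 1 by rewrite ler_pdivrMr// mul1r lerDl ltW// divr_gt0.
  by lra.
have h2 := powR_sum2 (ltW r0) (powR_ge0 (B + e / C) r^-1) M0.
have -> : C * (B + M `^ r) + e = 2 * (2 `^ r * (B + e / C + M `^ r)).
  by rewrite /C; field; rewrite gt_eqF// powR_gt0.
apply: le_trans (_ : 2 * ((B + e / C) `^ r^-1 + M) `^ r <= _).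
  by rewrite ler_wpM2r// powR_ge0.
rewrite ler_wpM2l// (le_trans h2)//.
by rewrite -powRrM mulVf ?gt_eqF// powRr1// ltW.
Qed.

(** * Rosenthal inequalities *)

Section independent_sums.
Context {d d'} {T : measurableType d} {S : measurableType d'} {R : realType}.
Context {P : probability T R} {I : finType} (X : I -> {RV P >-> S}).
Hypothesis indX : mutually_independent X.

Lemma bmf_coord (i : I) (f : S -> R) : bmf f -> bmf (fun x : fam I S => f (x i)).
Proof. exact: bmf_comp (measurable_coord i). Qed.

Lemma bmf_RV (i : I) (f : S -> R) : bmf f -> bmf (fun w => f (X i w)).
Proof. exact: bmf_comp (measurable_funP (X i)). Qed.

(** Redrawing every coordinate except [i] puts [f] on the first sample and [g], which ignores
    coordinate [i], on the second; the iterated integral then factors. *)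
Lemma Ex_indep (i : I) (f : S -> R) (g : fam I S -> R) : bmf f -> bmf g ->
    (forall x y : I -> S, (forall k, k != i -> x k = y k) -> g x = g y) ->
  \int[P]_w (f (X i w) * g (fun k => X k w)) =
  \int[P]_w f (X i w) * \int[P]_w g (fun k => X k w).
Proof.
move=> bf bg gi.
have bgX : bmf (fun w => g (fun k => X k w)).
  apply: (bmf_comp (g := fun w => (fun k => X k w) : fam I S)) bg.
  by apply: measurable_fam => k; exact: measurable_funP.
rewrite (resample indX [set i] (bmfM (bmf_coord i bf) bg)).
transitivity (\int[P]_w (f (X i w) * \int[P]_w' g (fun k => X k w'))).
  apply: eq_Rintegral => w _; rewrite -ExZ//; apply: eq_Rintegral => w' _.
  rewrite {1}/mix set11; congr (_ * _); apply: gi => k ki.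
  by rewrite /mix inE (negbTE ki).
by rewrite ExZr//; exact: bmf_RV.
Qed.

(** Each new variable is one [powR_recursion_step] with [r = p / 2]: the variance is [m], the slope
    [c = 6 p] satisfies [c r = 3 p^2], the second order coefficient of [powR_normD_le], and the
    additive error [b] is the [p]-th moment term. *)
Lemma rosenthal_seq (p beta : R) (psi : I -> S -> R) (s : seq I) : 2 <= p ->
    (forall i, bmf (psi i)) -> (forall i, \int[P]_w psi i (X i w) = 0) ->
    0 < beta -> uniq s ->
  \int[P]_w (`|\sum_(i <- s) psi i (X i w)| `^ p) <=
  (1 + (\sum_(i <- s) ((p + 1) `^ p * \int[P]_w (`|psi i (X i w)| `^ p))) / beta)
  * (beta `^ (p / 2)^-1 + \sum_(i <- s) 6 * p * \int[P]_w (psi i (X i w) ^+ 2))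
      `^ (p / 2).
Proof.
move=> p2 bpsi psi0 beta0; have p0 : 0 <= p by lra.
have pm2 : 0 <= p - 2 by lra.
elim: s => [_|i s IH /= /andP[is_ us]].
  rewrite !big_nil mul0r addr0 mul1r addr0.
  under eq_Rintegral do rewrite big_nil normr0.
  by rewrite Ex_cst powR0 ?powR_ge0//; lra.
have {}IH := IH us; rewrite !big_cons.
set B := \sum_(_ <- _) _ in IH *; set M := \sum_(_ <- _) _ in IH *.
set u := \int[P]_w _ in IH.
have bS : bmf (fun w => \sum_(j <- s) psi j (X j w)).
  by apply: bmf_sum => j; exact: bmf_RV.
have bSx : bmf (fun x : fam I S => \sum_(j <- s) psi j (x j)).
  by apply: bmf_sum => j; exact: bmf_coord.
have bZ : bmf (fun w => psi i (X i w)) by exact: bmf_RV.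
have Sx (x y : I -> S) : (forall k, k != i -> x k = y k) ->
    \sum_(j <- s) psi j (x j) = \sum_(j <- s) psi j (y j).
  move=> xy; apply: eq_big_seq => j js; rewrite xy//.
  by apply: contraNneq is_ => <-.
have B0 : 0 <= B.
  apply: sumr_ge0 => j _; rewrite mulr_ge0 ?powR_ge0//.
  by apply: Rintegral_ge0 => w _; exact: powR_ge0.
have M0 : 0 <= M.
  apply: sumr_ge0 => j _; rewrite !mulr_ge0//; try lra.
  by apply: Rintegral_ge0 => w _; exact: sqr_ge0.
set b := (p + 1) `^ p * _; set m := \int[P]_w (psi i (X i w) ^+ 2).
have -> : 1 + (b + B) / beta = (1 + B / beta) + b / beta by field; lra.
have -> : beta `^ (p / 2)^-1 + (6 * p * m + M) = (beta `^ (p / 2)^-1 + M) + 6 * p * m.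
  by ring.
have b0 : 0 <= b.
  by rewrite mulr_ge0 ?powR_ge0// Rintegral_ge0// => w _; exact: powR_ge0.
have m0 : 0 <= m by apply: Rintegral_ge0 => w _; exact: sqr_ge0.
apply: (powR_recursion_step (b := b) (u := u)) => //; try lra.
- by rewrite lerDl divr_ge0// ltW.
- by apply: Rintegral_ge0 => w _; exact: powR_ge0.
have -> : 6 * p * (p / 2) = 3 * p ^+ 2 by field.
set V := fun w => `|\sum_(j <- s) psi j (X j w)|.
apply: le_trans (_ : u + 3 * p ^+ 2 * (m * \int[P]_w (V w `^ (p - 2))) + b <= _); last first.
  rewrite !lerD2r lerD2l ler_wpM2l ?mulr_ge0 ?sqr_ge0// ler_wpM2l//.
  (* Lyapunov's inequality [E V^(p - 2) <= (E V^p)^((p - 2) / p)], by Jensen for a power at most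
     1. *)
  apply: le_trans (_ : \int[P]_w ((V w `^ p) `^ ((p / 2 - 1) / (p / 2))) <= _).
    apply: le_Ex => [||w]; [by rewrite /V; bmf_tac| |].
      apply: bmf_powR; last by rewrite /V; bmf_tac.
      by rewrite divr_ge0//; lra.
    rewrite -powRrM le_eqVlt; apply/orP; left; apply/eqP; congr powR.
    by field; lra.
  apply: Ex_powR_le => [||w]; [|by rewrite /V; bmf_tac|exact: powR_ge0].
  rewrite divr_ge0/=; [|lra|lra].
  by rewrite ler_pdivrMr; lra.
apply: le_trans (_ : \int[P]_w (V w `^ p +
   p * (psi i (X i w) * ((\sum_(j <- s) psi j (X j w)) * V w `^ (p - 2))) +
   3 * p ^+ 2 * (psi i (X i w) ^+ 2 * V w `^ (p - 2)) +
   (p + 1) `^ p * `|psi i (X i w)| `^ p) <= _).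
  apply: le_Ex => [||w]; rewrite ?/V.
  - under eq_fun do rewrite big_cons.
    by bmf_tac.
  - by bmf_tac.
  - by rewrite big_cons addrC; exact: powR_normD_le.
rewrite /V ExD; [|by bmf_tac..]; rewrite ExD; [|by bmf_tac..].
rewrite ExD; [|by bmf_tac..]; rewrite !ExZ; [|by bmf_tac..].
(* The new variable is independent of the earlier sum: centering removes the first order term, and
   the second order term releases the variance as a factor. *)
rewrite (Ex_indep (g := fun x => (\sum_(j <- s) psi j (x j)) *
   `|\sum_(j <- s) psi j (x j)| `^ (p - 2)) (bpsi i)).
- rewrite psi0 mul0r mulr0 addr0.
  rewrite (Ex_indep (f := fun x => psi i x ^+ 2) (g := fun x =>
   `|\sum_(j <- s) psi j (x j)| `^ (p - 2)))//.
  + exact: bmfX.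
  + by bmf_tac.
  + by move=> x y xy; rewrite (Sx x y).
- by bmf_tac.
- by move=> x y xy; rewrite (Sx x y).
Qed.

(** The constant is [12 = 2 * 6]: [powR_absorb] costs [2 * 2^(p / 2) <= 2^p], while 6 covers both
    the slope [6 p] and [p + 1 <= 6 p]. *)
Lemma rosenthal (p : R) (psi : I -> S -> R) (A : {set I}) : 2 <= p ->
    (forall i, bmf (psi i)) -> (forall i, \int[P]_w psi i (X i w) = 0) ->
  \int[P]_w (`|\sum_(i in A) psi i (X i w)| `^ p) <=
  12 `^ p * (p `^ (p / 2) * (\sum_(i in A) \int[P]_w (psi i (X i w) ^+ 2)) `^ (p / 2)
             + p `^ p * \sum_(i in A) \int[P]_w (`|psi i (X i w)| `^ p)).
Proof.
move=> p2 bpsi psi0.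
have pp1 : 0 <= p + 1 by lra.
have p6p : p + 1 <= 6 * p by lra.
have pp6 : 0 <= 6 * p by lra.
have r1 : 1 <= p / 2 by lra.
have rp : p / 2 <= p by lra.
have p0 : 0 <= p by lra.
set s2 := \sum_(i in A) _; set B := \sum_(i in A) _.
have s20 : 0 <= s2.
  by apply: sumr_ge0 => i _; apply: Rintegral_ge0 => w _; exact: sqr_ge0.
have B0 : 0 <= B.
  by apply: sumr_ge0 => i _; apply: Rintegral_ge0 => w _; exact: powR_ge0.
have pp0 := powR_ge0 (p + 1) p.
have := @powR_absorb R (p / 2) ((p + 1) `^ p * B) (6 * p * s2)
  (\int[P]_w (`|\sum_(i in A) psi i (X i w)| `^ p)) r1 (mulr_ge0 pp0 B0).
have ps0 : 0 <= 6 * p * s2 by rewrite !mulr_ge0.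
move=> /(_ ps0) h; apply: le_trans (h _) _ => [beta beta0|].
  have := rosenthal_seq p2 bpsi psi0 beta0 (enum_uniq A).
  rewrite !big_enum/= -!mulr_sumr.
  by under eq_Rintegral do rewrite big_enum.
have -> : (12 : R) = 2 * 6 by ring.
have -> : 2 * 2 `^ (p / 2) * ((p + 1) `^ p * B + (6 * p * s2) `^ (p / 2)) =
    (2 * 2 `^ (p / 2)) * ((p + 1) `^ p * B) +
    (2 * 2 `^ (p / 2)) * (6 `^ (p / 2) * (p `^ (p / 2) * s2 `^ (p / 2))).
  by rewrite mulrDr -[6 * p * s2]mulrA !powRM ?mulr_ge0.
have two : 2 * 2 `^ (p / 2) <= 2 `^ p :> R.
  have -> : 2 `^ p = 2 `^ (p / 2) * 2 `^ (p / 2) :> R.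
    by rewrite -powRD -?splitr// pnatr_eq0 implybT.
  by rewrite ler_wpM2r ?powR_ge0// le1r_powR// ler1n.
have six : 6 `^ (p / 2) <= 6 `^ p :> R by apply: ler_powR; rewrite ?ler1n.
rewrite powRM// mulrDr addrC lerD//.
  rewrite -[X in _ <= X]mulrA; apply: ler_pM; rewrite ?(mulr_ge0, powR_ge0)//.
  by rewrite ler_wpM2r// mulr_ge0 ?powR_ge0.
rewrite -[X in _ <= X]mulrA; apply: ler_pM; rewrite ?(mulr_ge0, powR_ge0)//.
rewrite mulrA ler_wpM2r// -(powRM p (ler0n R 6) p0).
by apply: ge0_ler_powR; rewrite ?nnegrE.
Qed.

(** The same recursion with the first order expansion [powR_addr_le]: means replace variances, and
    the slope is 4. *)
Lemma rosenthal_nonneg_seq (r beta : R) (xi : I -> S -> R) (s : seq I) : 1 <= r ->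
    (forall i, bmf (xi i)) -> (forall i x, 0 <= xi i x) ->
    0 < beta -> uniq s ->
  \int[P]_w ((\sum_(i <- s) xi i (X i w)) `^ r) <=
  (1 + (\sum_(i <- s) ((r + 1) `^ r * \int[P]_w (xi i (X i w) `^ r))) / beta)
  * (beta `^ r^-1 + \sum_(i <- s) 4 * \int[P]_w (xi i (X i w))) `^ r.
Proof.
move=> r1 bxi xi0 beta0; have r0 : 0 <= r by lra.
have rm1 : 0 <= r - 1 by lra.
elim: s => [_|i s IH /= /andP[is_ us]].
  rewrite !big_nil mul0r addr0 mul1r addr0.
  under eq_Rintegral do rewrite big_nil.
  by rewrite Ex_cst powR0 ?powR_ge0//; lra.
have {}IH := IH us; rewrite !big_cons.
set B := \sum_(_ <- _) _ in IH *; set M := \sum_(_ <- _) _ in IH *.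
set u := \int[P]_w _ in IH.
have bS : bmf (fun w => \sum_(j <- s) xi j (X j w)).
  by apply: bmf_sum => j; exact: bmf_RV.
have bSx : bmf (fun x : fam I S => \sum_(j <- s) xi j (x j)).
  by apply: bmf_sum => j; exact: bmf_coord.
have bZ : bmf (fun w => xi i (X i w)) by exact: bmf_RV.
have S0 w : 0 <= \sum_(j <- s) xi j (X j w) by apply: sumr_ge0.
have Sx (x y : I -> S) : (forall k, k != i -> x k = y k) ->
    \sum_(j <- s) xi j (x j) = \sum_(j <- s) xi j (y j).
  move=> xy; apply: eq_big_seq => j js; rewrite xy//.
  by apply: contraNneq is_ => <-.
have B0 : 0 <= B.
  apply: sumr_ge0 => j _; rewrite mulr_ge0 ?powR_ge0//.
  by apply: Rintegral_ge0 => w _; exact: powR_ge0.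
set b := (r + 1) `^ r * _; set m := \int[P]_w xi i (X i w).
have -> : 1 + (b + B) / beta = (1 + B / beta) + b / beta by field; lra.
have -> : beta `^ r^-1 + (4 * m + M) = (beta `^ r^-1 + M) + 4 * m by ring.
have b0 : 0 <= b.
  by rewrite mulr_ge0 ?powR_ge0// Rintegral_ge0// => w _; exact: powR_ge0.
have m0 : 0 <= m by apply: Rintegral_ge0.
have M0 : 0 <= M.
  by apply: sumr_ge0 => j _; rewrite mulr_ge0//; apply: Rintegral_ge0.
apply: (powR_recursion_step (b := b) (u := u)) => //; try lra.
- by rewrite lerDl divr_ge0// ltW.
- by apply: Rintegral_ge0 => w _; exact: powR_ge0.
set V := fun w => \sum_(j <- s) xi j (X j w).
apply: le_trans (_ : u + 4 * r * (m * \int[P]_w (V w `^ (r - 1))) + b <= _); last first.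
  rewrite !lerD2r lerD2l ler_wpM2l ?mulr_ge0 ?sqr_ge0// ler_wpM2l//.
  apply: le_trans (_ : \int[P]_w ((V w `^ r) `^ ((r - 1) / r)) <= _).
    apply: le_Ex => [||w]; [by rewrite /V; bmf_tac| |].
      by apply: bmf_powR; [rewrite divr_ge0|rewrite /V; bmf_tac].
    rewrite -powRrM le_eqVlt; apply/orP; left; apply/eqP; congr powR.
    by field; lra.
  apply: Ex_powR_le => [||w]; [|by rewrite /V; bmf_tac|exact: powR_ge0].
  by rewrite divr_ge0//= ler_pdivrMr; lra.
apply: le_trans (_ : \int[P]_w (V w `^ r +
   4 * r * (xi i (X i w) * V w `^ (r - 1)) +
   (r + 1) `^ r * xi i (X i w) `^ r) <= _).
  apply: le_Ex => [||w]; rewrite ?/V.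
  - under eq_fun do rewrite big_cons.
    by bmf_tac.
  - by bmf_tac.
  - by rewrite big_cons addrC; exact: powR_addr_le.
rewrite /V ExD; [|by bmf_tac..]; rewrite ExD; [|by bmf_tac..].
rewrite !ExZ; [|by bmf_tac..].
rewrite (Ex_indep (g := fun x => (\sum_(j <- s) xi j (x j)) `^ (r - 1)) (bxi i))//.
- by bmf_tac.
- by move=> x y xy; rewrite (Sx x y).
Qed.

Lemma rosenthal_nonneg (r : R) (xi : I -> S -> R) (A : {set I}) : 1 <= r ->
    (forall i, bmf (xi i)) -> (forall i x, 0 <= xi i x) ->
  \int[P]_w ((\sum_(i in A) xi i (X i w)) `^ r) <=
  16 `^ r * ((\sum_(i in A) \int[P]_w (xi i (X i w))) `^ r
             + r `^ r * \sum_(i in A) \int[P]_w (xi i (X i w) `^ r)).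
Proof.
move=> r1 bxi xi0.
have r0 : 0 <= r by lra.
have rr1 : 0 <= r + 1 by lra.
have r4 : r + 1 <= 4 * r by lra.
have r40 : 0 <= 4 * r by lra.
set m := \sum_(i in A) _; set B := \sum_(i in A) _.
have m0 : 0 <= m by apply: sumr_ge0 => i _; apply: Rintegral_ge0.
have B0 : 0 <= B.
  by apply: sumr_ge0 => i _; apply: Rintegral_ge0 => w _; exact: powR_ge0.
have pp0 := powR_ge0 (r + 1) r.
have := @powR_absorb R r ((r + 1) `^ r * B) (4 * m)
  (\int[P]_w ((\sum_(i in A) xi i (X i w)) `^ r)) r1 (mulr_ge0 pp0 B0).
move=> /(_ (mulr_ge0 (ler0n _ _) m0)) h; apply: le_trans (h _) _ => [beta beta0|].
  have := rosenthal_nonneg_seq r1 bxi xi0 beta0 (enum_uniq A).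
  rewrite !big_enum/= -!mulr_sumr.
  by under eq_Rintegral do rewrite big_enum.
have two : 2 * 2 `^ r <= 4 `^ r :> R.
  have -> : (4 : R) = 2 * 2 by ring.
  by rewrite powRM// ler_wpM2r ?powR_ge0// le1r_powR// ler1n.
have -> : (16 : R) = 4 * 4 by ring.
rewrite powRM// -[X in _ <= X]mulrA.
apply: ler_pM; rewrite ?(addr_ge0, mulr_ge0, powR_ge0)//.
rewrite mulrDr addrC powRM// lerD2l mulrA ler_wpM2r// -(powRM r (ler0n R 4) r0).
by apply: ge0_ler_powR; rewrite ?nnegrE.
Qed.

Lemma sum_setT (F : I -> R) : \sum_(i in [set: I]%SET) F i = \sum_i F i.
Proof. by apply: eq_bigl => i; rewrite inE. Qed.

Lemma rosenthalT (p : R) (psi : I -> S -> R) : 2 <= p ->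
    (forall i, bmf (psi i)) -> (forall i, \int[P]_w psi i (X i w) = 0) ->
  \int[P]_w (`|\sum_i psi i (X i w)| `^ p) <=
  12 `^ p * (p `^ (p / 2) * (\sum_i \int[P]_w (psi i (X i w) ^+ 2)) `^ (p / 2)
             + p `^ p * \sum_i \int[P]_w (`|psi i (X i w)| `^ p)).
Proof.
move=> p2 bpsi psi0; have := rosenthal [set: I]%SET p2 bpsi psi0.
by rewrite !sum_setT; under eq_Rintegral do rewrite sum_setT.
Qed.

End independent_sums.

(** * Sums of moments against moments of maxima *)

Lemma bmf_inv {d} {U : measurableType d} {R : realType} (f : U -> R) c :
  0 < c -> (forall x, c <= f x) -> bmf f -> bmf (fun x => (f x)^-1).
Proof.
move=> c0 cf [mf _].
have f0 x : 0 < f x by exact: lt_le_trans c0 (cf x).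
split; last first.
  exists c^-1 => x; rewrite normfV gtr0_norm// lef_pV2 ?posrE//.
have := measurableT_comp (measurable_powR (-1)) mf.
by apply: eq_measurable_fun => x _ /=; rewrite powR_inv1// ltW.
Qed.

Section sum_max.
Context {d d'} {T : measurableType d} {S : measurableType d'} {R : realType}.
Context {P : probability T R} {I : finType} (X : I -> {RV P >-> S}).
Hypothesis indX : mutually_independent X.

(* With [R_i] the sum of the other variables,
   [max^q >= sum_i xi_i^(q+1) / (xi_i + R_i)]; the tangent to [1 / t] at
   [xi_i + m] linearizes this in [R_i], which is independent of [xi_i] and has
   mean at most [m]. *)
Lemma sum_le_max_aux (xi : I -> R) (q m : R) : 0 <= q -> 0 < m ->
    (forall i, 0 <= xi i) ->
  \sum_i (2 * (xi i `^ (q + 1) * (xi i + m)^-1)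
          - xi i `^ (q + 1) * (xi i + m)^-1 ^+ 2 * (xi i + \sum_(k | k != i) xi k))
  <= (\big[Num.max/0]_i xi i) `^ q.
Proof.
move=> q0 m0 xi0.
have sumE i : xi i + \sum_(k | k != i) xi k = \sum_k xi k by rewrite [RHS](bigD1 i).
under eq_bigr do rewrite sumE.
set s := \sum_k xi k; set M := \big[Num.max/_]_i _.
have xiM i : xi i <= M by exact: (le_bigmax _ xi).
have s0 : 0 <= s by apply: sumr_ge0.
have [s00|sN0] := eqVneq s 0.
  rewrite big1 ?powR_ge0// => i _.
  have -> : xi i = 0.
    exact: (psumr_eq0P (fun i _ => xi0 i) s00).
  by rewrite powR0 ?mul0r ?mulr0 ?subr0//; lra.
have {}s0 : 0 < s by rewrite lt_neqAle eq_sym sN0.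
apply: le_trans (_ : \sum_i M `^ q * (xi i / s) <= _); last first.
  by rewrite -mulr_sumr -mulr_suml divff// mulr1.
apply: ler_sum => i _.
have -> : xi i `^ (q + 1) = xi i `^ q * xi i.
  have [->|xN0] := eqVneq (xi i) 0; first by rewrite mulr0 powR0//; lra.
  by rewrite powRD ?powRr1// xN0 implybT.
have ht : 2 * (xi i + m)^-1 - (xi i + m)^-1 ^+ 2 * s <= s^-1.
  have := xi0 i; set t := (xi i + m)^-1; move=> _.
  have : 0 <= (s * t - 1) ^+ 2 * s^-1 by rewrite mulr_ge0 ?sqr_ge0// invr_ge0 ltW.
  have -> : (s * t - 1) ^+ 2 * s^-1 = s^-1 - (2 * t - t ^+ 2 * s) by field.
  by rewrite subr_ge0.
have hq : xi i `^ q <= M `^ q.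
  by apply: ge0_ler_powR; rewrite ?nnegrE ?(le_trans (xi0 i) (xiM i)).
have p0 := powR_ge0 (xi i) q.
apply: le_trans (_ : xi i `^ q * xi i * s^-1 <= _).
  have : 0 <= xi i `^ q * xi i by rewrite mulr_ge0.
  move=> /ler_wpM2l/(_ _ _ ht); lra.
by rewrite -mulrA ler_wpM2r// divr_ge0// ltW.
Qed.

(** The intermediate quantity is [al(x) = x^(q + 1) / (x + m)]: the sum of its expectations is at
    most the moment of the maximum, and up to the factor [1 + L] it dominates [x^q] wherever [x] is
    at least [m / L]. *)
Lemma sum_le_max (xi : I -> S -> R) (q L : R) : 1 <= q -> 0 < L ->
    (forall i, bmf (xi i)) -> (forall i x, 0 <= xi i x) ->
  \sum_i \int[P]_w (xi i (X i w) `^ q) <=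
  (L `^ (q - 1))^-1 * (\sum_i \int[P]_w xi i (X i w)) `^ q
  + (1 + L) * \int[P]_w ((\big[Num.max/0]_i xi i (X i w)) `^ q).
Proof.
move=> q1 L0 bxi xi0; set m := \sum_i \int[P]_w xi i (X i w).
set EM := \int[P]_w _; have q0 : 0 <= q by lra.
have qp : 0 < q by lra.
have qm1 : 0 <= q - 1 by lra.
have EM0 : 0 <= EM by apply: Rintegral_ge0 => w _; exact: powR_ge0.
have bZ i : bmf (fun w => xi i (X i w)) by exact: (bmf_RV X i (bxi i)).
have m0i i : 0 <= \int[P]_w xi i (X i w) by apply: Rintegral_ge0.
have m0 : 0 <= m by apply: sumr_ge0.
have [m00|mN0] := eqVneq m 0.
  rewrite m00 powR0 ?mulr0 ?add0r; last by lra.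
  rewrite big1 ?mulr_ge0//; first by lra.
  move=> i _; have [_ [C xiC]] := bZ i.
  have C0 (w : T) : 0 <= C by exact: le_trans (normr_ge0 _) (xiC w).
  apply/eqP; rewrite eq_le; apply/andP; split; last first.
    by apply: Rintegral_ge0 => w _; exact: powR_ge0.
  (* If all means vanish, so do the moments, since [x^q <= C^(q - 1) x] for [x] bounded by [C]. *)
  have -> : 0 = C `^ (q - 1) * \int[P]_w xi i (X i w).
    move/eqP: m00; rewrite psumr_eq0// => /allP/(_ i).
    by rewrite mem_index_enum => /(_ isT)/eqP ->; rewrite mulr0.
  rewrite -ExZ//; apply: le_Ex => [||w]; [by bmf_tac..|].
  rewrite -(mulr_powRB1 (xi0 _ _) qp).
  rewrite mulrC ler_wpM2r//; apply: ge0_ler_powR; rewrite ?nnegrE ?(C0 w)//.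
  exact: le_trans (ler_norm _) (xiC w).
have {}m0 : 0 < m by rewrite lt_neqAle eq_sym mN0.
have mL0 : 0 <= m / L by rewrite divr_ge0// ltW.
pose al x : R := x `^ (q + 1) * (x + m)^-1.
pose be x : R := x `^ (q + 1) * (x + m)^-1 ^+ 2.
have q10 : 0 <= q + 1 by lra.
have binv i : bmf (fun x => (xi i x + m)^-1).
  by apply: (bmf_inv m0) => [x|]; [rewrite lerDr|bmf_tac].
have bal i : bmf (fun x => al (xi i x)) by rewrite /al; bmf_tac.
have bbe i : bmf (fun x => be (xi i x)) by rewrite /be; bmf_tac.
have balX i : bmf (fun w => al (xi i (X i w))) by exact: (bmf_RV X i (bal i)).
have bbeX i : bmf (fun w => be (xi i (X i w))) by exact: (bmf_RV X i (bbe i)).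
have be0 i x : 0 <= be (xi i x).
  by rewrite mulr_ge0 ?powR_ge0 ?sqr_ge0.
have alM : \sum_i \int[P]_w al (xi i (X i w)) <= EM.
  apply: le_trans (_ : \int[P]_w (\sum_i (2 * al (xi i (X i w)) -
      be (xi i (X i w)) * (xi i (X i w) + \sum_(k | k != i) xi k (X k w)))) <= _);
    last first.
    apply: le_Ex => [||w]; [by bmf_tac|by bmf_tac|].
    by apply: sum_le_max_aux => // i; exact: xi0.
  rewrite Ex_sum; last by move=> i; bmf_tac.
  apply: ler_sum => i _.
  have bR : bmf (fun x : fam I S => \sum_(k | k != i) xi k (x k)).
    by apply: bmf_sum => k; exact: bmf_coord.
  have bRX : bmf (fun w => \sum_(k | k != i) xi k (X k w)) by bmf_tac.
  have Eind : \int[P]_w (be (xi i (X i w)) * \sum_(k | k != i) xi k (X k w)) =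
      \int[P]_w be (xi i (X i w)) * \int[P]_w (\sum_(k | k != i) xi k (X k w)).
    apply: (Ex_indep indX (bbe i) bR) => x y xy.
    by apply: eq_bigr => k /xy ->.
  (* As the other variables have total mean at most [m], the subtracted part is at most
     [E (x + m) be(x) = E al(x)], which leaves one of the two copies of [E al(x)]. *)
  have xbe w : xi i (X i w) * be (xi i (X i w)) + m * be (xi i (X i w)) =
      al (xi i (X i w)).
    rewrite /be /al; have := xi0 i (X i w); set x := xi i _ => x0.
    by field; lra.
  have -> : \int[P]_w (2 * al (xi i (X i w)) -
      be (xi i (X i w)) * (xi i (X i w) + \sum_(k | k != i) xi k (X k w))) =
      2 * \int[P]_w al (xi i (X i w)) -
      (\int[P]_w (xi i (X i w) * be (xi i (X i w))) +
       \int[P]_w (be (xi i (X i w)) * \sum_(k | k != i) xi k (X k w))).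
    rewrite -ExD; [|by bmf_tac..]; rewrite -ExZ// -ExN; last by bmf_tac.
    rewrite -ExD; [|by bmf_tac..]; apply: eq_Rintegral => w _.
    by rewrite mulrDr [xi i _ * be _]mulrC.
  rewrite Eind Ex_sum//.
  have : \int[P]_w al (xi i (X i w)) =
      \int[P]_w (xi i (X i w) * be (xi i (X i w))) +
      m * \int[P]_w be (xi i (X i w)).
    rewrite -ExZ// -ExD; [|by bmf_tac..].
    by apply: eq_Rintegral => w _; rewrite xbe.
  have : \int[P]_w be (xi i (X i w)) *
      (\sum_(k | k != i) \int[P]_w xi k (X k w)) <=
      \int[P]_w be (xi i (X i w)) * m.
    rewrite ler_wpM2l//; first by apply: Rintegral_ge0 => w _; exact: be0.
    by rewrite /m [leRHS](bigD1 i)//= lerDr.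
  lra.
rewrite addrC; apply: le_trans (_ : (1 + L) * \sum_i \int[P]_w al (xi i (X i w)) +
    (m / L) `^ (q - 1) * m <= _); last first.
  rewrite lerD//; first by rewrite ler_wpM2l//; lra.
  rewrite powRM ?invr_ge0 ?(ltW m0) ?(ltW L0)//.
  rewrite -(mulr_powRB1 (ltW m0) qp).
  have -> : L^-1 `^ (q - 1) = (L `^ (q - 1))^-1.
    by rewrite -powR_inv1 ?(ltW L0)// powRAC powR_inv1// powR_ge0.
  by rewrite le_eqVlt; apply/orP; left; apply/eqP; ring.
rewrite {2}/m !mulr_sumr -big_split/=; apply: ler_sum => i _.
have L1 : 0 <= 1 + L by lra.
rewrite -!ExZ// -ExD; [|by bmf_tac..].
apply: le_Ex => [||w]; [by bmf_tac..|].
have := xi0 i (X i w); set x := xi i _ => x0; rewrite /al.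
have xm : 0 < x + m by lra.
have xq : x `^ (q + 1) = x `^ q * x.
  have [->|xN0] := eqVneq x 0; first by rewrite mulr0 powR0//; lra.
  by rewrite powRD ?powRr1// xN0 implybT.
(* Above [m / L], [x + m <= (1 + L) x]. Below it, [x^q <= (m / L)^(q - 1) x], and the means of these
   bounds add up to [L^(1 - q) m^q]. *)
have [xL|xL] := leP (m / L) x.
  rewrite ler_wpDr ?mulr_ge0 ?powR_ge0//.
  have h1 : x + m <= (1 + L) * x by move: xL; rewrite ler_pdivrMr//; lra.
  rewrite xq mulrA ler_pdivlMr//.
  have := ler_wpM2l (powR_ge0 x q) h1; lra.
rewrite ler_wpDl ?mulr_ge0 ?powR_ge0 ?invr_ge0 ?(ltW xm)//.
rewrite -(mulr_powRB1 x0 qp).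
rewrite mulrC ler_wpM2r//; apply: ge0_ler_powR; rewrite ?nnegrE//; lra.
Qed.

End sum_max.

(** * Almost sure comparison of expectations *)

Section almost_everywhere.
Context {d} {T : measurableType d} {R : realType} (P : probability T R).
Implicit Types f g : T -> R.

Lemma le_Ex_ae f g : bmf f -> bmf g -> (forall w, 0 <= f w) ->
    (forall w, 0 <= g w) -> {ae P, forall w, f w <= g w} ->
  \int[P]_w f w <= \int[P]_w g w.
Proof.
move=> bf bg f0 g0 fg; rewrite -lee_fin -!EFin_Rintegral//.
apply: ae_ge0_le_integral => //.
- by move=> w _; rewrite lee_fin.
- by apply/measurable_EFinP; case: bf.
- by move=> w _; rewrite lee_fin.
- by apply/measurable_EFinP; case: bg.
- by apply: filterS fg => w fgw _; rewrite lee_fin.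
Qed.

Lemma Ex_ae0 f : bmf f -> {ae P, forall w, f w = 0} -> \int[P]_w f w = 0.
Proof.
move=> bf f0; rewrite /Rintegral (ae_eq_integral (cst 0%E))//.
- by rewrite integral0.
- by apply/measurable_EFinP; case: bf.
- by apply: filterS f0 => w fw _; rewrite fw.
Qed.

End almost_everywhere.

(** * Cauchy-Schwarz and decoupling of finite sums *)

Section finite_algebra.
Context {R : realFieldType}.

(** The minimum is at [t = c / v]. For [v = 0] the polynomial is affine and takes the value -1 at
    [t = (u + 1) / (2 c)], unless [c = 0]. *)
Lemma sqr_le_of_quadratic (u c v : R) : 0 <= u -> 0 <= v ->
  (forall t, 0 <= u - 2 * t * c + t ^+ 2 * v) -> c ^+ 2 <= u * v.
Proof.
move=> u0 v0 H; have [v00|vN0] := eqVneq v 0; last first.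
  have {}v0 : 0 < v by rewrite lt_neqAle eq_sym vN0.
  have := H (c / v).
  have -> : u - 2 * (c / v) * c + (c / v) ^+ 2 * v = (u * v - c ^+ 2) / v by field.
  by rewrite pmulr_lge0 ?invr_gt0// subr_ge0.
have [->|cN0] := eqVneq c 0; first by rewrite expr0n mulr_ge0.
have := H ((u + 1) / (2 * c)); rewrite v00 mulr0 addr0.
have -> : u - 2 * ((u + 1) / (2 * c)) * c = -1 by field.
by rewrite ler0N1.
Qed.

(** Toggling the membership of [i] in [J] is an involution that changes one sign and keeps the
    other, so the sum is its own opposite. *)
Lemma sum_sign (n : nat) (i k : 'I_n) : i != k ->
  \sum_(J : {set 'I_n}) (-1) ^+ (i \in J) * (-1) ^+ (k \in J) = 0 :> R.
Proof.
move=> ik; set s := \sum_J _.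
pose flip (J : {set 'I_n}) := if i \in J then (J :\ i)%SET else (i |: J)%SET.
have flipK : involutive flip.
  move=> J; rewrite /flip; case: (boolP (i \in J)) => iJ.
    by rewrite !inE eqxx/= finset.setD1K.
  by rewrite !inE eqxx/= finset.setU1K.
have : s = - s.
  rewrite /s -sumrN [LHS](reindex_inj (inv_inj flipK)); apply: eq_bigr => J _.
  have -> : (k \in flip J) = (k \in J).
    by rewrite /flip; case: ifP => _; rewrite !inE eq_sym (negbTE ik).
  have -> : (i \in flip J) = ~~ (i \in J).
    by rewrite /flip; case: ifP => iJ; rewrite !inE eqxx// iJ.
  by rewrite signrN mulNr.
by move=> /eqP; rewrite -subr_eq0 opprK -mulr2n mulrn_eq0/= => /eqP.
Qed.

(* Averaging [(sum a)^2 - (sum of signs times a)^2] over all signs. *)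
Lemma sqr_sum_decouple (n : nat) (a : 'I_n -> R) :
  (\sum_i a i) ^+ 2 = \sum_i a i ^+ 2 +
   #|{set 'I_n}|%:R^-1 * \sum_(J : {set 'I_n})
      4 * ((\sum_(i in J) a i) * (\sum_(i in ~: J) a i)).
Proof.
set N := #|_|; have N0 : N%:R != 0 :> R.
  by rewrite pnatr_eq0 -lt0n; apply/card_gt0P; exists finset.set0.
pose e (J : {set 'I_n}) i : R := (-1) ^+ (i \in J).
(* Polarization: [4 x y = (x + y)^2 - (y - x)^2]. *)
have prodE (J : {set 'I_n}) : 4 * ((\sum_(i in J) a i) * (\sum_(i in ~: J) a i)) =
    (\sum_i a i) ^+ 2 - (\sum_i e J i * a i) ^+ 2.
  have -> : \sum_i a i = \sum_(i in J) a i + \sum_(i in ~: J) a i.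
    by rewrite (bigID (mem J))/=; congr (_ + _); apply: eq_bigl => i; rewrite inE.
  have -> : \sum_i e J i * a i = - \sum_(i in J) a i + \sum_(i in ~: J) a i.
    rewrite (bigID (mem J))/= -sumrN; congr (_ + _).
      by apply: eq_bigr => i iJ; rewrite /e iJ mulN1r.
    rewrite [RHS](eq_bigl (fun i => i \notin J)); last by move=> i; rewrite inE.
    by apply: eq_bigr => i /negbTE iJ; rewrite /e iJ mul1r.
  by ring.
under [X in _ + _ * X]eq_bigr do rewrite prodE.
rewrite big_split/= sumr_const -/N sumrN.
have -> : \sum_(J : {set 'I_n}) (\sum_i e J i * a i) ^+ 2 = N%:R * \sum_i a i ^+ 2.
  under eq_bigr do rewrite expr2 big_distrlr/=.
  rewrite exchange_big/= mulr_sumr; apply: eq_bigr => i _.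
  rewrite exchange_big/= (bigD1 i)//= [X in _ + X]big1 ?addr0 => [|k ki].
        transitivity (\sum_(J : {set 'I_n}) a i ^+ 2).
      by apply: eq_bigr => J _; rewrite mulrACA -expr2 sqrr_sign mul1r.
    by rewrite sumr_const mulr_natl.
  under eq_bigr do rewrite mulrACA.
  by rewrite -mulr_suml sum_sign ?mul0r// eq_sym.
by rewrite -mulr_natl; field.
Qed.

End finite_algebra.

(** * The decoupled moment inequality *)

(* The bookkeeping at the end of the proof, with [u = p^(p/2)] and [L = p^4];
   [mr], [s], [Mx], [My], [Mh] are the quantities on the right-hand side. *)
Lemma moment_accounting (R : realFieldType)
    (u L k4 k16 kk k12 mr s Mx My Mh Ex Ey D EQ c2 W Hh lhs : R) :
    1 <= u -> 0 <= L -> 1 <= k16 -> 1 <= kk -> 1 <= k12 -> 0 <= k4 ->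
    k16 <= kk -> k4 * k16 <= 2 * kk ->
    0 <= mr -> 0 <= s -> 0 <= Mx -> 0 <= My -> 0 <= Mh ->
    0 <= Ex -> 0 <= Ey ->
    Ex <= L / u ^+ 4 * mr + (1 + L) * Mx ->
    Ey <= L / u ^+ 4 * mr + (1 + L) * My ->
    D <= k16 * (mr + u * Ex) ->
    EQ <= k4 * D + kk * c2 ->
    u * c2 <= 8 * (1 + L) ^+ 2 * (u * mr + u ^+ 2 * s + u ^+ 3 * Mx) ->
    Hh <= L / u ^+ 4 * Ey + (1 + L) * (L / u ^+ 4 * D + (1 + L) * Mh) ->
    W <= k12 * (u * Ey + u ^+ 2 * Hh) ->
    lhs <= k12 * (u * EQ + u ^+ 2 * W) ->
  lhs <= k12 ^+ 2 * kk * (1 + L) ^+ 3 * 17 *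
    (u * mr + u ^+ 2 * s + u ^+ 3 * (Mx + My) + u ^+ 4 * Mh).
Proof.
(* In the application [Ex], [Ey], [Hh] are the sums of row, column and entry moments, [D] is the
   moment of the sum of the [xi_i], [EQ] that of the squared norm [Q], [c2] the squared chaos
   coefficient, and [W] the sum of the [p]-th moments of the column sums. *)
move=> u1 L0 k161 kk1 k121 k40 k16k kk4 mr0 s0 Mx0 My0 Mh0 Ex0 Ey0.
move=> hEx hEy hD hEQ hc2 hHh hW hl.
have u0 : 0 < u by lra.
have k160 : 0 <= k16 by lra.
have kk0 : 0 <= kk by lra.
have k120 : 0 <= k12 by lra.
have uk k : 0 <= u ^+ k by rewrite exprn_ge0// ltW.
have uk1 k : 1 <= u ^+ k by exact: exprn_ege1.
set T := _ + _ + _ + _; set l := 1 + L in hEx hEy hc2 hHh *.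
have l1 : 1 <= l by rewrite /l; lra.
have l0 : 0 <= l by lra.
have Ll : L <= l by rewrite /l; lra.
have a0 : 0 <= u * mr by rewrite mulr_ge0// ltW.
have b0 : 0 <= u ^+ 2 * s by rewrite mulr_ge0.
have c0 : 0 <= u ^+ 3 * Mx by rewrite mulr_ge0.
have d0 : 0 <= u ^+ 3 * My by rewrite mulr_ge0.
have e0 : 0 <= u ^+ 4 * Mh by rewrite mulr_ge0.
have TE : T = u * mr + u ^+ 2 * s + (u ^+ 3 * Mx + u ^+ 3 * My) + u ^+ 4 * Mh.
  by rewrite /T mulrDr.
have T0 : 0 <= T by rewrite TE; lra.
(* The factor [L / u^4] outweighs the prefactor [u^3]: what remains of [mr] is [L / u], below the
   allowed [l u]. *)
have cancel3 E M : E <= L / u ^+ 4 * mr + l * M -> u * mr + u ^+ 3 * M <= T ->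
    u ^+ 3 * E <= l * T.
  move=> hE hT; apply: le_trans (ler_wpM2l (uk 3) hE) _.
  apply: le_trans (ler_wpM2l l0 hT); rewrite !mulrDr.
  have -> : u ^+ 3 * (l * M) = l * (u ^+ 3 * M) by ring.
  rewrite lerD2r.
  have -> : u ^+ 3 * (L / u ^+ 4 * mr) = L * (u^-1 * mr) by field; rewrite gt_eqF.
  apply: ler_pM => //; first by rewrite mulr_ge0// invr_ge0 ltW.
  by rewrite ler_wpM2r// (le_trans _ u1)// invf_le1.
have hx : u ^+ 3 * Ex <= l * T by apply: cancel3 hEx _; rewrite TE; lra.
have hy : u ^+ 3 * Ey <= l * T by apply: cancel3 hEy _; rewrite TE; lra.
have lT : T <= l * T by rewrite ler_peMl.
have hx2 : u ^+ 2 * Ex <= l * T.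
  by apply: le_trans hx; rewrite ler_wpM2r// [u ^+ 3]exprS ler_peMl.
have uD : u * D <= 2 * k16 * (l * T).
  apply: le_trans (ler_wpM2l (ltW u0) hD) _.
  have -> : u * (k16 * (mr + u * Ex)) = k16 * (u * mr + u ^+ 2 * Ex) by ring.
  have -> : 2 * k16 * (l * T) = k16 * (2 * (l * T)) by ring.
  rewrite ler_wpM2l//.
  have : u * mr <= T by rewrite TE; lra.
  by lra.
have l2T : l * T <= l ^+ 2 * T by rewrite expr2 -mulrA ler_peMl// mulr_ge0.
have l3T : l ^+ 2 * T <= l ^+ 3 * T.
  by rewrite [l ^+ 3]exprS -mulrA ler_peMl// mulr_ge0// exprn_ge0.
have uEQ : u * EQ <= 12 * kk * (l ^+ 3 * T).
  apply: le_trans (ler_wpM2l (ltW u0) hEQ) _.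
  have -> : u * (k4 * D + kk * c2) = k4 * (u * D) + kk * (u * c2) by ring.
  have h1 : k4 * (u * D) <= 4 * kk * (l * T).
    apply: le_trans (ler_wpM2l k40 uD) _.
    have -> : k4 * (2 * k16 * (l * T)) = 2 * (l * T) * (k4 * k16) by ring.
    have -> : 4 * kk * (l * T) = 2 * (l * T) * (2 * kk) by ring.
    by rewrite ler_wpM2l// !mulr_ge0.
  have h2 : kk * (u * c2) <= 8 * kk * (l ^+ 2 * T).
    have -> : 8 * kk * (l ^+ 2 * T) = kk * (8 * l ^+ 2 * T) by ring.
    rewrite ler_wpM2l//; apply: le_trans hc2 _; rewrite ler_wpM2l ?mulr_ge0 ?sqr_ge0//.
    by rewrite TE; lra.
  have h3 : kk * (l * T) <= kk * (l ^+ 3 * T) by rewrite ler_wpM2l//; lra.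
  have h4 : kk * (l ^+ 2 * T) <= kk * (l ^+ 3 * T) by rewrite ler_wpM2l//; lra.
  by lra.
have hH : u ^+ 4 * Hh <= 4 * kk * (l ^+ 3 * T).
  apply: le_trans (ler_wpM2l (uk 4) hHh) _.
  have -> : u ^+ 4 * (L / u ^+ 4 * Ey + l * (L / u ^+ 4 * D + l * Mh)) =
      L * Ey + l * (L * D + l * (u ^+ 4 * Mh)) by field; rewrite gt_eqF.
  have h1 : L * Ey <= l ^+ 2 * T.
    rewrite expr2 -mulrA; apply: ler_pM => //.
    by apply: le_trans hy; rewrite ler_peMl.
  have h2 : l * (L * D) <= 2 * k16 * (l ^+ 3 * T).
    have -> : 2 * k16 * (l ^+ 3 * T) = l * (l * (2 * k16 * (l * T))) by ring.
    rewrite ler_wpM2l//.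
    have [D0|D0] := leP 0 D.
      by apply: ler_pM => //; apply: le_trans uD; rewrite ler_peMl.
    rewrite (@le_trans _ _ 0)//; first by rewrite mulr_ge0_le0// ltW.
    by rewrite !mulr_ge0//; lra.
  have h3 : l * (l * (u ^+ 4 * Mh)) <= l ^+ 2 * T.
    by rewrite mulrA -expr2 ler_wpM2l ?sqr_ge0// TE; lra.
  have h4 : k16 * (l ^+ 3 * T) <= kk * (l ^+ 3 * T).
    by rewrite ler_wpM2r// mulr_ge0// exprn_ge0.
  have h5 : l ^+ 3 * T <= kk * (l ^+ 3 * T).
    by rewrite ler_peMl// mulr_ge0// exprn_ge0.
  rewrite mulrDr; lra.
have hy' : u ^+ 3 * Ey <= kk * (l ^+ 3 * T).
  apply: le_trans hy _; apply: le_trans l2T _; apply: le_trans l3T _.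
  by rewrite ler_peMl// mulr_ge0// exprn_ge0.
apply: le_trans hl _.
have h1 : u ^+ 2 * W <= k12 * (5 * kk * (l ^+ 3 * T)).
  apply: le_trans (ler_wpM2l (uk 2) hW) _.
  have -> : u ^+ 2 * (k12 * (u * Ey + u ^+ 2 * Hh)) =
    k12 * (u ^+ 3 * Ey + u ^+ 4 * Hh) by ring.
  by rewrite ler_wpM2l//; lra.
have h2 : 12 * kk * (l ^+ 3 * T) <= k12 * (12 * kk * (l ^+ 3 * T)).
  by rewrite ler_peMl// !mulr_ge0 ?exprn_ge0//; lra.
(* The constant 17 is 12 from [EQ] plus 5 from [W], the latter being 1 for the columns and 4 for the
   entries. *)
have -> : k12 ^+ 2 * kk * l ^+ 3 * 17 * T = k12 * (k12 * (12 * kk * (l ^+ 3 * T)) +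
   k12 * (5 * kk * (l ^+ 3 * T))) by ring.
by rewrite ler_wpM2l//; lra.
Qed.

Ltac measurable_tac := solve
  [ exact: measurable_cst | exact: measurable_id | exact: measurable_fst
  | exact: measurable_snd | exact: measurable_funP | exact: measurable_coord
  | exact: (measurableT_comp (measurable_funP _) measurable_snd)
  | exact: (measurableT_comp (measurable_funP _) measurable_fst)
  | exact: (measurableT_comp (measurable_coord _) measurable_fst)
  | exact: (measurableT_comp (measurable_coord _) measurable_snd) ].

Section decoupled.
Context {d d'} {T : measurableType d} {S : measurableType d'} {R : realType}.
Context {P : probability T R} {n : nat} (X1 X2 : 'I_n -> {RV P >-> S}).
Context (h : 'I_n -> 'I_n -> S * S -> R).
Hypothesis ind1 : mutually_independent X1.
Hypothesis ind2 : mutually_independent X2.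
Hypothesis bh : forall i j, bmf (h i j).
Hypothesis deg1 : forall i j, {ae P, forall w, \int[P]_w' h i j (X1 i w', X2 j w) = 0}.
Hypothesis deg2 : forall i j, {ae P, forall w, \int[P]_w' h i j (X1 i w, X2 j w') = 0}.

Lemma bmf_kernel {dU} {U : measurableType dU} i j (a b : U -> S) :
  measurable_fun setT a -> measurable_fun setT b ->
  bmf (fun u => h i j (a u, b u)).
Proof. by move=> ma mb; apply: bmf_comp (bh i j); exact: measurable_fun_pair. Qed.

Ltac kernel_tac := bmf_tac; try (apply: bmf_kernel; measurable_tac).

(** * The Hilbert space valued sum over the first family *)

Definition slice (J : {set 'I_n}) (x : 'I_n -> S) (j : 'I_n) (y : S) : R :=
  \sum_(i in J) h i j (x i, y).

(** [xi_i] of the overview: the squared norm of the vector [(h_ij(s, .))_j] in the direct sum over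
    [j] of the L2 spaces of the laws of [X2 j]. *)
Definition sqnorm (i : 'I_n) (s : S) : R :=
  \sum_j \int[P]_w (h i j (s, X2 j w) ^+ 2).

(** The squared norm, in the same space, of the sum of the vectors indexed by [J]; for the full set
    it is [Q]. *)
Definition sqnorm_sum (J : {set 'I_n}) (x : 'I_n -> S) : R :=
  \sum_j \int[P]_w (slice J x j (X2 j w) ^+ 2).

(** The inner product of vector [i] at [s] with the block sum over [J]. Keeping [s] apart from [x]
    allows the block to be frozen while [s] is integrated. *)
Definition inner (J : {set 'I_n}) (x : 'I_n -> S) (i : 'I_n) (s : S) : R :=
  \sum_j \int[P]_w (h i j (s, X2 j w) * slice J x j (X2 j w)).

Lemma bmf_sqnorm i : bmf (sqnorm i).
Proof. by rewrite /sqnorm; kernel_tac. Qed.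

Lemma sqnorm_ge0 i s : 0 <= sqnorm i s.
Proof. by apply: sumr_ge0 => j _; apply: Rintegral_ge0 => w _; exact: sqr_ge0. Qed.

Lemma bmf_sqnorm_sum J : bmf (sqnorm_sum J : fam 'I_n S -> R).
Proof. by rewrite /sqnorm_sum /slice; kernel_tac. Qed.

Lemma sqnorm_sum_ge0 J x : 0 <= sqnorm_sum J x.
Proof. by apply: sumr_ge0 => j _; apply: Rintegral_ge0 => w _; exact: sqr_ge0. Qed.

Lemma bmf_inner J x i : bmf (inner J x i).
Proof. by rewrite /inner /slice; kernel_tac. Qed.

Lemma bmf_inner_diag J i : bmf (fun x : fam 'I_n S => inner J x i (x i)).
Proof. by rewrite /inner /slice; kernel_tac. Qed.

Lemma bmf_slice J x j : bmf (fun w => slice J x j (X2 j w)).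
Proof. by rewrite /slice; kernel_tac. Qed.

Lemma bmf_section i j s : bmf (fun w => h i j (s, X2 j w)).
Proof. by kernel_tac. Qed.

(** [sqr_sum_decouple] for each [j] and [y], applied to the values extended by zero outside [J],
    then integrated in [y] and summed over [j]. *)
Lemma sqnorm_sum_decouple (J : {set 'I_n}) (x : 'I_n -> S) :
  sqnorm_sum J x = \sum_(i in J) sqnorm i (x i) +
   #|{set 'I_n}|%:R^-1 * \sum_(A : {set 'I_n})
      4 * \sum_(i in J :&: A) inner (J :\: A) x i (x i).
Proof.
have pointwise j y : slice J x j y ^+ 2 =
    \sum_(i in J) h i j (x i, y) ^+ 2 +
    #|{set 'I_n}|%:R^-1 * \sum_(A : {set 'I_n})
      4 * \sum_(i in J :&: A) h i j (x i, y) * slice (J :\: A) x j y.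
  rewrite /slice big_mkcond/= sqr_sum_decouple; congr (_ + _ * _).
    rewrite [RHS]big_mkcond/=; apply: eq_bigr => i _.
    by case: ifP => // _; rewrite expr0n.
  apply: eq_bigr => A _; rewrite -mulr_suml; congr (_ * (_ * _)).
    rewrite -big_mkcondr/=; apply: eq_bigl => i.
    by rewrite !inE andbC.
  by rewrite -big_mkcondr/=; apply: eq_bigl => i; rewrite !inE.
rewrite /sqnorm_sum /sqnorm /inner.
transitivity (\sum_j (\sum_(i in J) \int[P]_w (h i j (x i, X2 j w) ^+ 2) +
   #|{set 'I_n}|%:R^-1 * \sum_(A : {set 'I_n}) 4 * \sum_(i in J :&: A)
     \int[P]_w (h i j (x i, X2 j w) * slice (J :\: A) x j (X2 j w)))).
  apply: eq_bigr => j _.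
  have bs A := bmf_slice A x j.
  have bk i := bmf_section i j (x i).
  under eq_Rintegral do rewrite pointwise.
  rewrite ExD; [|by bmf_tac..]; rewrite Ex_sum; last by move=> i; bmf_tac.
  congr (_ + _); rewrite ExZ; last by bmf_tac.
  rewrite Ex_sum; last by move=> A; bmf_tac.
  congr (_ * _); apply: eq_bigr => A _; rewrite ExZ; last by bmf_tac.
  by rewrite Ex_sum// => i; bmf_tac.
rewrite big_split/= exchange_big/=; congr (_ + _).
rewrite -mulr_sumr exchange_big/=; congr (_ * _); apply: eq_bigr => A _.
by rewrite -mulr_sumr exchange_big.
Qed.

Lemma inner_sqr_le J x i s : inner J x i s ^+ 2 <= sqnorm i s * sqnorm_sum J x.
Proof.
apply: sqr_le_of_quadratic => [||t]; [exact: sqnorm_ge0|exact: sqnorm_sum_ge0|].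
rewrite /sqnorm /sqnorm_sum /inner mulr_sumr mulr_sumr -sumrB -big_split/=.
apply: sumr_ge0 => j _.
have bs := bmf_slice J x j; have bk := bmf_section i j s.
rewrite -!ExZ; [|by bmf_tac..]; rewrite -ExN; last by bmf_tac.
rewrite -!ExD; [|by bmf_tac..]; apply: Rintegral_ge0 => w _.
set a := h _ _ _; set b := slice _ _ _ _.
have -> : a ^+ 2 + - (2 * t * (a * b)) + t ^+ 2 * b ^+ 2 = (a - t * b) ^+ 2 by ring.
exact: sqr_ge0.
Qed.

(** With the block frozen, Fubini moves [E_1] next to the kernel, where degeneracy applies. This
    centering is what [rosenthal] requires. *)
Lemma Ex_inner J x i : \int[P]_w inner J x i (X1 i w) = 0.
Proof.
rewrite /inner Ex_sum => [|j]; last by rewrite /slice; kernel_tac.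
rewrite big1// => j _; have bs := bmf_slice J x j.
rewrite Ex_swap; last by rewrite /slice; kernel_tac.
apply: Ex_ae0; first by rewrite /slice; kernel_tac.
apply: filterS (deg1 i j) => w e.
rewrite ExZr ?e ?mul0r//; kernel_tac.
Qed.

Definition total_variance : R := \sum_i \int[P]_w sqnorm i (X1 i w).

Lemma total_variance_ge0 : 0 <= total_variance.
Proof.
by apply: sumr_ge0 => i _; apply: Rintegral_ge0 => w _; exact: sqnorm_ge0.
Qed.

(** The Hilbert-Schmidt bound, by Cauchy-Schwarz in each term; it is used for exponents below 2. *)
Lemma inner_variance_le_total J x (A : {set 'I_n}) :
  \sum_(i in A) \int[P]_w (inner J x i (X1 i w) ^+ 2) <=
  total_variance * sqnorm_sum J x.
Proof.
have bi i := bmf_RV X1 i (bmf_inner J x i).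
have bq i := bmf_RV X1 i (bmf_sqnorm i).
apply: le_trans (_ : \sum_i \int[P]_w (inner J x i (X1 i w) ^+ 2) <= _).
  rewrite [leRHS](bigID (mem A))/= lerDl; apply: sumr_ge0 => i _.
  by apply: Rintegral_ge0 => w _; exact: sqr_ge0.
rewrite /total_variance mulr_suml; apply: ler_sum => i _.
rewrite -(ExZr P _ (bq i)); apply: le_Ex => [||w].
- exact: bmfX.
- by apply: bmfM => //; exact: bmf_cst.
- exact: inner_sqr_le.
Qed.

Lemma inner_powR_le J x i s q : 0 <= q ->
  `|inner J x i s| `^ q <= sqnorm i s `^ (q / 2) * sqnorm_sum J x `^ (q / 2).
Proof.
move=> q0; rewrite -powRM ?sqnorm_ge0 ?sqnorm_sum_ge0//.
have -> : `|inner J x i s| `^ q = (inner J x i s ^+ 2) `^ (q / 2).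
  by rewrite -real_normK ?num_real// -powR_mulrn// -powRrM; congr powR; field.
apply: ge0_ler_powR; rewrite ?nnegrE ?sqr_ge0 ?divr_ge0//.
  by rewrite mulr_ge0 ?sqnorm_ge0 ?sqnorm_sum_ge0.
exact: inner_sqr_le.
Qed.

(** The operator norm enters only through [op_le]: bounded test functions, and the two families
    already integrated separately. *)
Variable sigma : R.
Hypothesis sigma_ge0 : 0 <= sigma.
Hypothesis op_le : forall f g : 'I_n -> S -> R,
  (forall i, bmf (f i)) -> (forall j, bmf (g j)) ->
  \sum_i \int[P]_w (f i (X1 i w) ^+ 2) <= 1 ->
  \sum_j \int[P]_w (g j (X2 j w) ^+ 2) <= 1 ->
  \int[P]_w \int[P]_w' (\sum_i \sum_j
     h i j (X1 i w, X2 j w') * f i (X1 i w) * g j (X2 j w')) <= sigma.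

(* The operator norm is tested on [f = inner J x] and [g = slice J x]. *)
Lemma inner_variance_le_op J x (A : {set 'I_n}) :
  \sum_(i in A) \int[P]_w (inner J x i (X1 i w) ^+ 2) <=
  sigma ^+ 2 * sqnorm_sum J x.
Proof.
have bi i := bmf_inner J x i.
have biX i := bmf_RV X1 i (bmf_inner J x i).
have bs j := bmf_slice J x j.
set V := \sum_i \int[P]_w (inner J x i (X1 i w) ^+ 2).
set Q := sqnorm_sum J x; have Q0 : 0 <= Q by exact: sqnorm_sum_ge0.
apply: le_trans (_ : V <= _).
  rewrite [leRHS](bigID (mem A))/= lerDl; apply: sumr_ge0 => i _.
  by apply: Rintegral_ge0 => w _; exact: sqr_ge0.
have V0 : 0 <= V.
  by apply: sumr_ge0 => i _; apply: Rintegral_ge0 => w _; exact: sqr_ge0.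
have [->|VN0] := eqVneq V 0; first by rewrite mulr_ge0 ?sqr_ge0.
have {}V0 : 0 < V by rewrite lt_neqAle eq_sym VN0.
(* [Q] may be 0, so the second test function is normalized by [Q + e]. *)
suff H e : 0 < e -> V <= sigma ^+ 2 * (Q + e).
  have s20 : 0 < sigma ^+ 2 + 1 by rewrite ltr_wpDl ?sqr_ge0.
  apply/ler_addgt0Pr => e e0; apply: le_trans (H (e / (sigma ^+ 2 + 1)) _) _.
    by rewrite divr_gt0.
  rewrite mulrDr lerD2l mulrCA -[leRHS]mulr1 ler_wpM2l ?(ltW e0)//.
  by rewrite ler_pdivrMr// mul1r lerDl.
move=> e0; have Qe0 : 0 < Q + e by rewrite ltr_wpDl.
pose a := (Num.sqrt V)^-1; pose b := (Num.sqrt (Q + e))^-1.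
have a2 : a ^+ 2 = V^-1 by rewrite exprVn sqr_sqrtr// ltW.
have b2 : b ^+ 2 = (Q + e)^-1 by rewrite exprVn sqr_sqrtr// ltW.
have := @op_le (fun i s => a * inner J x i s) (fun j y => b * slice J x j y).
(* The pairing of the normalized test functions is [a b V], the square root of [V / (Q + e)]. *)
have -> : \int[P]_w \int[P]_w' (\sum_i \sum_j h i j (X1 i w, X2 j w') *
    (a * inner J x i (X1 i w)) * (b * slice J x j (X2 j w'))) = a * b * V.
  transitivity (\int[P]_w (a * b * \sum_i inner J x i (X1 i w) ^+ 2)).
    apply: eq_Rintegral => w _.
    rewrite Ex_sum => [|i]; last by rewrite /slice; kernel_tac.
    rewrite mulr_sumr; apply: eq_bigr => i _.
    rewrite Ex_sum => [|j]; last by rewrite /slice; kernel_tac.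
    have : inner J x i (X1 i w) = \sum_j \int[P]_w' (h i j (X1 i w, X2 j w') *
        slice J x j (X2 j w')) by [].
    move: (inner J x i (X1 i w)) => v vE.
    rewrite expr2 [X in _ * (_ * X)]vE !mulr_sumr; apply: eq_bigr => j _.
    rewrite -!ExZ; [|by rewrite /slice; kernel_tac..].
    by apply: eq_Rintegral => w' _; ring.
  by rewrite ExZ ?Ex_sum// => [i|]; bmf_tac.
move=> H; apply: le_trans (_ : (a * b * V) ^+ 2 * (Q + e) <= _).
  rewrite !exprMn a2 b2 le_eqVlt; apply/orP; left; apply/eqP.
  by field; rewrite !gt_eqF.
have a0 : 0 <= a by rewrite invr_ge0 sqrtr_ge0.
have b0 : 0 <= b by rewrite invr_ge0 sqrtr_ge0.
rewrite ler_wpM2r ?(ltW Qe0)//; apply: lerXn2r; rewrite ?nnegrE//.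
  by rewrite !mulr_ge0// ltW.
apply: H.
- by move=> i; bmf_tac.
- by move=> j; rewrite /slice; kernel_tac.
- under eq_bigr => i _ do under eq_Rintegral do rewrite exprMn.
  under eq_bigr => i _ do (rewrite ExZ; last by bmf_tac).
  by rewrite -mulr_sumr -/V a2 mulVf.
- under eq_bigr => j _ do under eq_Rintegral do rewrite exprMn.
  under eq_bigr => j _ do (rewrite ExZ; last by bmf_tac).
  rewrite -mulr_sumr -/(sqnorm_sum J x) -/Q b2 mulrC ler_pdivrMr// mul1r lerDl.
  exact: ltW.
Qed.

(* For [r < 2] the exponent is too small for [rosenthal]; second moments and
   Jensen's inequality then suffice. *)
Definition chaos_coeff (r : R) : R :=
  if 2 <= r then
    r `^ (r / 2) * (sigma ^+ 2) `^ (r / 2) +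
    r `^ r * \sum_i \int[P]_w (sqnorm i (X1 i w) `^ (r / 2))
  else total_variance `^ (r / 2).

Lemma chaos_coeff_ge0 r : 0 <= chaos_coeff r.
Proof.
rewrite /chaos_coeff; case: ifP => _; rewrite ?powR_ge0//.
rewrite addr_ge0 ?mulr_ge0 ?powR_ge0// sumr_ge0// => i _.
by apply: Rintegral_ge0 => w _; exact: powR_ge0.
Qed.

(** With [x] frozen the summands are independent, real and centered. Their variances and their
    [r]-th moments are all controlled by powers of the norm of the block, which therefore factors
    out. *)
Lemma inner_moment_le r J x (A : {set 'I_n}) : 1 <= r ->
  \int[P]_w (`|\sum_(i in A) inner J x i (X1 i w)| `^ r) <=
  30 `^ r * (chaos_coeff r * sqnorm_sum J x `^ (r / 2)).
Proof.
move=> r1; have r0 : 0 <= r by lra.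
have bi i := bmf_inner J x i; have biX i := bmf_RV X1 i (bi i).
have bqX i := bmf_RV X1 i (bmf_sqnorm i).
have Q0 := sqnorm_sum_ge0 J x; have m0 := total_variance_ge0.
have r20 : 0 <= r / 2 by lra.
rewrite /chaos_coeff; case: ifPn => [r2|]; last first.
  rewrite -ltNge => r2.
  set a := fun w => `|\sum_(i in A) inner J x i (X1 i w)|.
  have ba : bmf a by rewrite /a; bmf_tac.
  have c0 : 0 <= 30 :> R by lra.
  have -> : 30 `^ r * (total_variance `^ (r / 2) * sqnorm_sum J x `^ (r / 2)) =
      (30 `^ 2 * (total_variance * sqnorm_sum J x)) `^ (r / 2).
    rewrite powRM ?mulr_ge0 ?powR_ge0// [in RHS]powRM//; congr (_ * _).
    by rewrite -powRrM; congr powR; field.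
  apply: le_trans (_ : (\int[P]_w (a w `^ 2)) `^ (r / 2) <= _).
    apply: le_trans (_ : \int[P]_w ((a w `^ 2) `^ (r / 2)) <= _).
      apply: le_Ex => [||w]; [by bmf_tac|by bmf_tac|].
      by rewrite -powRrM le_eqVlt; apply/orP; left; apply/eqP; congr powR; field.
    apply: Ex_powR_le => [||w]; [lra|by bmf_tac|exact: powR_ge0].
  apply: ge0_ler_powR; rewrite ?nnegrE ?mulr_ge0//.
    by apply: Rintegral_ge0 => w _; exact: powR_ge0.
  (* At exponent 2 this gives [12^2 (2 + 4) = 864] times the variance, below [30^2]: the origin of
     the constant 30. *)
  apply: le_trans (rosenthal ind1 A (lexx 2) bi (Ex_inner J x)) _.
  have -> : \sum_(i in A) \int[P]_w (`|inner J x i (X1 i w)| `^ 2) =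
      \sum_(i in A) \int[P]_w (inner J x i (X1 i w) ^+ 2).
    apply: eq_bigr => i _; apply: eq_Rintegral => w _.
    by rewrite powR_mulrn// real_normK ?num_real.
  rewrite divff// !powRr1//; last first.
    by apply: sumr_ge0 => i _; apply: Rintegral_ge0 => w _; exact: sqr_ge0.
  rewrite !(powR_mulrn 2)//; try lra.
  have := inner_variance_le_total J x A.
  have : 0 <= total_variance * sqnorm_sum J x by rewrite mulr_ge0.
  by lra.
apply: le_trans (rosenthal ind1 A r2 bi (Ex_inner J x)) _.
apply: ler_pM; rewrite ?powR_ge0//.
- rewrite addr_ge0 ?mulr_ge0 ?powR_ge0// sumr_ge0// => i _.
  by apply: Rintegral_ge0 => w _; exact: powR_ge0.
- by apply: ge0_ler_powR; rewrite ?nnegrE//; lra.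
rewrite mulrDl -!mulrA; apply: lerD; rewrite ler_wpM2l ?powR_ge0//.
  rewrite -powRM ?sqr_ge0//; apply: ge0_ler_powR; rewrite ?nnegrE ?mulr_ge0 ?sqr_ge0//.
    by apply: sumr_ge0 => i _; apply: Rintegral_ge0 => w _; exact: sqr_ge0.
  exact: inner_variance_le_op.
rewrite mulr_suml; apply: le_trans (_ : \sum_i \int[P]_w (`|inner J x i (X1 i w)| `^ r) <= _).
  rewrite [leRHS](bigID (mem A))/= lerDl; apply: sumr_ge0 => i _.
  by apply: Rintegral_ge0 => w _; exact: powR_ge0.
apply: ler_sum => i _; rewrite -ExZr; last by bmf_tac.
apply: le_Ex => [||w]; [by bmf_tac|by bmf_tac|exact: inner_powR_le].
Qed.

(** The coordinates in [A] are redrawn: the block over [J :\: A] keeps the first sample, the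
    summands over [J :&: A] use the second, and [inner_moment_le] applies for each fixed first
    sample. *)
Lemma mixed_inner_moment_le r J (A : {set 'I_n}) : 1 <= r ->
  \int[P]_w (`|\sum_(i in J :&: A) inner (J :\: A) (X1 ^~ w) i (X1 i w)| `^ r) <=
  30 `^ r * (chaos_coeff r *
     \int[P]_w (sqnorm_sum (J :\: A) (X1 ^~ w) `^ (r / 2))).
Proof.
move=> r1; have r0 : 0 <= r by lra.
have r20 : 0 <= r / 2 by lra.
have bQX : bmf (fun w => sqnorm_sum (J :\: A) (X1 ^~ w)).
  apply: (bmf_comp (g := fun w => (X1 ^~ w) : fam 'I_n S)) (bmf_sqnorm_sum _).
  by apply: measurable_fam => k; exact: measurable_funP.
have bd i := bmf_inner_diag (J :\: A) i.
have bG : bmf (fun x : fam 'I_n S =>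
    `|\sum_(i in J :&: A) inner (J :\: A) x i (x i)| `^ r).
  by apply: bmf_powR => //; apply: bmf_norm; apply: bmf_sum => i; exact: bd.
rewrite (resample ind1 (~: A) bG).
have mixE w w' i : i \in J :&: A ->
    inner (J :\: A) (mix (~: A) (X1 ^~ w) (X1 ^~ w')) i
      (mix (~: A) (X1 ^~ w) (X1 ^~ w') i) =
    inner (J :\: A) (X1 ^~ w) i (X1 i w').
  rewrite inE => /andP[iJ iA]; rewrite {2}/mix inE iA/=.
  rewrite /inner; apply: eq_bigr => j _; apply: eq_Rintegral => w0 _.
  congr (_ * _); apply: eq_bigr => k; rewrite inE => /andP[kA kJ].
  by rewrite /mix inE kA.
apply: le_trans (_ : \int[P]_w (30 `^ r * (chaos_coeff r *
    sqnorm_sum (J :\: A) (X1 ^~ w) `^ (r / 2))) <= _); last first.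
  by rewrite ExZ ?ExZ//; [apply: bmf_powR|apply: bmfM; [exact: bmf_cst|exact: bmf_powR]].
apply: le_Ex => [||w].
- by apply: bmf_Ex; exact: (bmf_comp (measurable_joint_mix X1 (~: A)) bG).
- apply: bmfM; first exact: bmf_cst.
  by apply: bmfM; [exact: bmf_cst|exact: bmf_powR].
apply: le_trans (inner_moment_le (J :\: A) (X1 ^~ w) (J :&: A) r1).
rewrite le_eqVlt; apply/orP; left; apply/eqP.
apply: eq_Rintegral => w' _; congr (`|_| `^ _); apply: eq_bigr => i iJA.
exact: mixE.
Qed.

(* The supremum over [J] of the moments satisfies [A <= c + A / 2], because the
   decoupled blocks are again sums of the same kind over smaller sets. *)
Lemma sqnorm_sum_moment_le r (J : {set 'I_n}) : 1 <= r ->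
  \int[P]_w (sqnorm_sum J (X1 ^~ w) `^ r) <=
  2 * 2 `^ r * \int[P]_w ((\sum_i sqnorm i (X1 i w)) `^ r) +
  (240 `^ r * chaos_coeff r) ^+ 2.
Proof.
move=> r1; have r0 : 0 <= r by lra.
have r20 : 0 <= r / 2 by lra.
set N : R := #|{set 'I_n}|%:R^-1.
have N0 : 0 <= N by rewrite invr_ge0.
have bQX A : bmf (fun w => sqnorm_sum A (X1 ^~ w)).
  apply: (bmf_comp (g := fun w => (X1 ^~ w) : fam 'I_n S)) (bmf_sqnorm_sum A).
  by apply: measurable_fam => k; exact: measurable_funP.
have bqX i := bmf_RV X1 i (bmf_sqnorm i).
set D := \int[P]_w ((\sum_i sqnorm i (X1 i w)) `^ r).
have D0 : 0 <= D by apply: Rintegral_ge0 => w _; exact: powR_ge0.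
(* [240 = 2 * 4 * 30]: 2 from [powR_sum2], 4 from decoupling, 30 from [inner_moment_le]. *)
set B := 240 `^ r * chaos_coeff r.
have B0 : 0 <= B by rewrite mulr_ge0 ?powR_ge0 ?chaos_coeff_ge0.
pose mom J := \int[P]_w (sqnorm_sum J (X1 ^~ w) `^ r).
have mom0 A : 0 <= mom A by apply: Rintegral_ge0 => w _; exact: powR_ge0.
set M := \big[Num.max/0]_J mom J.
have momM A : mom A <= M by exact: le_bigmax.
suff H A : mom A <= 2 `^ r * D + 2^-1 * M + 2^-1 * B ^+ 2.
  have M0 : 0 <= M := le_trans (mom0 finset.set0) (momM finset.set0).
  have : M <= 2 `^ r * D + 2^-1 * M + 2^-1 * B ^+ 2.
    apply: bigmax_le => //.
    by rewrite !addr_ge0 ?mulr_ge0 ?(powR_ge0, sqr_ge0, invr_ge0, chaos_coeff_ge0).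
  have := momM J; rewrite /mom; lra.
have bc A' : bmf (fun w => \sum_(i in A :&: A') inner (A :\: A') (X1 ^~ w) i (X1 i w)).
  apply: bmf_sum => i.
  apply: (bmf_comp (g := fun w => (X1 ^~ w) : fam 'I_n S)) (bmf_inner_diag _ i).
  by apply: measurable_fam => k; exact: measurable_funP.
pose C A' w := \sum_(i in A :&: A') inner (A :\: A') (X1 ^~ w) i (X1 i w).
have bCr A' : bmf (fun w => `|C A' w| `^ r).
  by apply: bmf_powR => //; apply: bmf_norm; exact: bc.
have bD : bmf (fun w => (\sum_i sqnorm i (X1 i w)) `^ r).
  by apply: bmf_powR => //; apply: bmf_sum => i; exact: bqX.
apply: le_trans (_ : \int[P]_w (2 `^ r * (\sum_i sqnorm i (X1 i w)) `^ r +
    N * \sum_(A' : {set 'I_n}) 8 `^ r * `|C A' w| `^ r) <= _).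
  apply: le_Ex => [||w].
  - exact: bmf_powR.
  - apply: bmfD; first by apply: bmfM => //; exact: bmf_cst.
    apply: bmfM; first exact: bmf_cst.
    by apply: bmf_sum => A'; apply: bmfM => //; exact: bmf_cst.
  rewrite sqnorm_sum_decouple -/N.
  apply: le_trans (_ : (\sum_i sqnorm i (X1 i w) +
      N * \sum_(A' : {set 'I_n}) 4 * `|C A' w|) `^ r <= _).
    apply: ge0_ler_powR; rewrite ?nnegrE//.
    + have := sqnorm_sum_ge0 A (X1 ^~ w).
      by rewrite sqnorm_sum_decouple.
    + apply: addr_ge0; first by apply: sumr_ge0 => i _; exact: sqnorm_ge0.
      by apply: mulr_ge0 => //; apply: sumr_ge0 => A' _; exact: mulr_ge0.
    apply: lerD.
      rewrite [leRHS](bigID (mem A))/= lerDl; apply: sumr_ge0 => i _.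
      exact: sqnorm_ge0.
    rewrite ler_wpM2l//; apply: ler_sum => A' _.
    by rewrite ler_wpM2l// ler_norm.
  apply: le_trans (powR_sum2 r0 _ _) _.
  + by apply: sumr_ge0 => i _; exact: sqnorm_ge0.
  + by rewrite mulr_ge0// sumr_ge0// => A' _; rewrite mulr_ge0.
  rewrite mulrDr lerD2l.
  have := @powR_mean R {set 'I_n} (fun A' => 4 * `|C A' w|) r r1.
  move=> /(_ (fun A' => mulr_ge0 (ler0n _ 4) (normr_ge0 _))).
  rewrite -/N => /(ler_wpM2l (powR_ge0 2 r)) /le_trans; apply.
  rewrite mulrCA ler_wpM2l// mulr_sumr; apply: ler_sum => A' _.
  have -> : (8 : R) = 2 * 4 by ring.
  by rewrite !powRM// mulrA.
rewrite ExD; last first.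
- apply: bmfM; first exact: bmf_cst.
  by apply: bmf_sum => A'; apply: bmfM => //; exact: bmf_cst.
- by apply: bmfM => //; exact: bmf_cst.
rewrite ExZ// -/D -addrA lerD2l ExZ; last first.
  by apply: bmf_sum => A'; apply: bmfM => //; exact: bmf_cst.
rewrite Ex_sum; last by move=> A'; apply: bmfM => //; exact: bmf_cst.
apply: le_trans (_ : N * \sum_(A' : {set 'I_n}) (2^-1 * M + 2^-1 * B ^+ 2) <= _); last first.
  move: (2^-1 * M + _) => z; rewrite sumr_const -mulr_natl mulrA mulVf ?mul1r//.
  by rewrite pnatr_eq0 -lt0n; apply/card_gt0P; exists finset.set0.
rewrite ler_wpM2l//; apply: ler_sum => A' _; rewrite ExZ//.
apply: le_trans (_ : 8 `^ r * (30 `^ r * (chaos_coeff r *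
    \int[P]_w (sqnorm_sum (A :\: A') (X1 ^~ w) `^ (r / 2)))) <= _).
  by rewrite ler_wpM2l ?powR_ge0//; exact: mixed_inner_moment_le.
have -> : 8 `^ r * (30 `^ r * (chaos_coeff r *
    \int[P]_w (sqnorm_sum (A :\: A') (X1 ^~ w) `^ (r / 2)))) =
    \int[P]_w (B * sqnorm_sum (A :\: A') (X1 ^~ w) `^ (r / 2)).
  rewrite ExZ; last exact: bmf_powR.
  have -> : B = 8 `^ r * 30 `^ r * chaos_coeff r.
    by rewrite /B -powRM//; congr (powR _ _ * _); ring.
  by rewrite !mulrA.
(* [B y <= y^2 / 2 + B^2 / 2] with [y] the power [r / 2] of the squared norm of the block; the first
   half is what [M] absorbs. *)
apply: le_trans (_ : 2^-1 * mom (A :\: A') + 2^-1 * B ^+ 2 <= _); last first.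
  by rewrite lerD2r ler_wpM2l ?invr_ge0.
rewrite /mom -ExZ; last exact: bmf_powR.
rewrite -[X in _ + X](Ex_cst P) -ExD; last 2 first.
- by apply: bmfM; [exact: bmf_cst|exact: bmf_powR].
- exact: bmf_cst.
apply: le_Ex => [||w].
- by apply: bmfM; [exact: bmf_cst|exact: bmf_powR].
- apply: bmfD; last exact: bmf_cst.
  by apply: bmfM; [exact: bmf_cst|exact: bmf_powR].
set t := sqnorm_sum _ _; have -> : t `^ r = (t `^ (r / 2)) ^+ 2.
  by rewrite -powR_mulrn ?powR_ge0// -powRrM; congr powR; field.
have := sqr_ge0 (t `^ (r / 2) - B); lra.
Qed.

(** * Row, column and entry moments at a fixed exponent *)

Definition cosqnorm (j : 'I_n) (y : S) : R :=
  \sum_i \int[P]_w (h i j (X1 i w, y) ^+ 2).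

Lemma bmf_cosqnorm j : bmf (cosqnorm j).
Proof. by rewrite /cosqnorm; kernel_tac. Qed.

Lemma cosqnorm_ge0 j y : 0 <= cosqnorm j y.
Proof. by apply: sumr_ge0 => i _; apply: Rintegral_ge0 => w _; exact: sqr_ge0. Qed.

Lemma sum_cosqnorm : \sum_j \int[P]_w cosqnorm j (X2 j w) = total_variance.
Proof.
rewrite /total_variance /cosqnorm /sqnorm.
transitivity (\sum_j \sum_i \int[P]_w' \int[P]_w (h i j (X1 i w, X2 j w') ^+ 2)).
  apply: eq_bigr => j _; rewrite Ex_sum// => i; kernel_tac.
rewrite exchange_big/=; apply: eq_bigr => i _.
rewrite Ex_sum => [|j]; last by kernel_tac.
apply: eq_bigr => j _; rewrite [RHS]Ex_swap//; kernel_tac.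
Qed.

Variables (p : R).
Hypothesis p2 : 2 <= p.
Let r := p / 2.
(** With this level [L^(1 - r) = p^4 / p^(2 p)], which cancels the heaviest prefactor [p^(2 p)]. *)
Let L := p ^+ 4.

Let r1 : 1 <= r. Proof. by rewrite /r ler_pdivlMr// mul1r. Qed.
Let r0 : 0 <= r. Proof. exact: le_trans ler01 r1. Qed.
Let pgt0 : 0 < p. Proof. exact: lt_le_trans p2. Qed.
Let L0 : 0 < L. Proof. exact: exprn_gt0. Qed.

Definition max_row := \int[P]_w ((\big[Num.max/0]_i sqnorm i (X1 i w)) `^ r).
Definition max_col := \int[P]_w ((\big[Num.max/0]_j cosqnorm j (X2 j w)) `^ r).
(** The maxima are nested, over [i] inside [j], because [sum_le_max] is applied once in each
    family. *)
Definition max_entry := \int[P]_w \int[P]_w'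
  ((\big[Num.max/0]_j \big[Num.max/0]_i h i j (X1 i w, X2 j w') ^+ 2) `^ r).

Lemma row_sum_le : \sum_i \int[P]_w (sqnorm i (X1 i w) `^ r) <=
  (L `^ (r - 1))^-1 * total_variance `^ r + (1 + L) * max_row.
Proof.
exact: (sum_le_max ind1 r1 L0 bmf_sqnorm sqnorm_ge0).
Qed.

Lemma col_sum_le : \sum_j \int[P]_w (cosqnorm j (X2 j w) `^ r) <=
  (L `^ (r - 1))^-1 * total_variance `^ r + (1 + L) * max_col.
Proof.
rewrite -sum_cosqnorm.
exact: (sum_le_max ind2 r1 L0 bmf_cosqnorm cosqnorm_ge0).
Qed.

Lemma sqnorm_total_le : \int[P]_w ((\sum_i sqnorm i (X1 i w)) `^ r) <=
  16 `^ r * (total_variance `^ r + r `^ r * \sum_i \int[P]_w (sqnorm i (X1 i w) `^ r)).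
Proof.
have := rosenthal_nonneg ind1 [set: 'I_n]%SET r1 bmf_sqnorm sqnorm_ge0.
under eq_Rintegral do under eq_bigl do rewrite inE.
rewrite /total_variance.
under eq_bigl do rewrite inE.
by under [X in _ <= _ * (_ + _ * X)]eq_bigl do rewrite inE.
Qed.

Lemma bmf_colmax j : bmf (fun w =>
  \int[P]_w' ((\big[Num.max/0]_i h i j (X1 i w, X2 j w') ^+ 2) `^ r)).
Proof. by kernel_tac. Qed.

(** [sum_le_max] over [i] for a fixed second sample, where the means add up to [cosqnorm j], then
    over [j] for a fixed first sample, applied to the maxima over [i]. Bounding a maximum by a sum,
    the means of these add up to at most the sum of the [sqnorm i]. *)
Lemma entry_sum_le : \sum_j \sum_i \int[P]_w' \int[P]_w
     ((h i j (X1 i w, X2 j w') ^+ 2) `^ r) <=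
  (L `^ (r - 1))^-1 * \sum_j \int[P]_w (cosqnorm j (X2 j w) `^ r) +
  (1 + L) * ((L `^ (r - 1))^-1 * \int[P]_w ((\sum_i sqnorm i (X1 i w)) `^ r) +
             (1 + L) * max_entry).
Proof.
have Lr0 : 0 <= (L `^ (r - 1))^-1 by rewrite invr_ge0 powR_ge0.
have L10 : 0 <= 1 + L by have := L0; lra.
have bk i j y : bmf (fun s => h i j (s, y) ^+ 2) by kernel_tac.
have bcX j : bmf (fun w => cosqnorm j (X2 j w)) by exact: (bmf_RV X2 j (bmf_cosqnorm j)).
have b1 j : bmf (fun w' => \int[P]_w ((\big[Num.max/0]_i h i j (X1 i w, X2 j w') ^+ 2) `^ r)).
  by kernel_tac.
apply: le_trans (_ : \sum_j ((L `^ (r - 1))^-1 * \int[P]_w (cosqnorm j (X2 j w) `^ r) +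
    (1 + L) * \int[P]_w' \int[P]_w
       ((\big[Num.max/0]_i h i j (X1 i w, X2 j w') ^+ 2) `^ r)) <= _).
  apply: ler_sum => j _.
  rewrite -!ExZ//; last by bmf_tac.
  rewrite -ExD; [|by bmf_tac..].
  rewrite -Ex_sum => [|i]; last by kernel_tac.
  apply: le_Ex => [||w']; [by kernel_tac|by bmf_tac|].
  exact: (sum_le_max (xi := fun i s => h i j (s, X2 j w') ^+ 2) ind1 r1 L0
    (fun i => bk i j _) (fun i s => sqr_ge0 _)).
rewrite big_split/= -!mulr_sumr lerD2l ler_wpM2l//.
have bz x j : bmf (fun y => \big[Num.max/0]_i h i j (x i, y) ^+ 2) by kernel_tac.
have z0 x j y : 0 <= \big[Num.max/0]_i h i j (x i, y) ^+ 2 by exact: bigmax_ge_id.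
have bqX i := bmf_RV X1 i (bmf_sqnorm i).
have bE : bmf (fun w => \int[P]_w' ((\big[Num.max/0]_j
    \big[Num.max/0]_i h i j (X1 i w, X2 j w') ^+ 2) `^ r)) by kernel_tac.
rewrite /max_entry -!ExZ//; last by bmf_tac.
rewrite -ExD; [|by bmf_tac..].
under eq_bigr => j _ do (rewrite Ex_swap; last by kernel_tac).
rewrite -Ex_sum; last exact: bmf_colmax.
apply: le_Ex => [||w]; [exact: (bmf_sum _ _ bmf_colmax)|by bmf_tac|].
apply: le_trans (sum_le_max ind2 r1 L0 (bz (X1 ^~ w)) (z0 (X1 ^~ w))) _.
rewrite lerD2r ler_wpM2l//; apply: ge0_ler_powR; rewrite ?nnegrE//.
- by apply: sumr_ge0 => j _; apply: Rintegral_ge0.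
- by apply: sumr_ge0 => i _; exact: sqnorm_ge0.
rewrite /sqnorm exchange_big/=; apply: ler_sum => j _.
rewrite -Ex_sum => [|i]; last by kernel_tac.
apply: le_Ex => [||w']; [by kernel_tac|by kernel_tac|].
apply: bigmax_le => [|i _]; first by apply: sumr_ge0 => i _; exact: sqr_ge0.
by rewrite (bigD1 i)//= lerDl sumr_ge0// => k _; exact: sqr_ge0.
Qed.

Let u := p `^ r.
Let m0 : 0 <= total_variance. Proof. exact: total_variance_ge0. Qed.

Lemma powR_half_mul (k : nat) : p `^ (k%:R * p / 2) = u ^+ k.
Proof.
rewrite -powR_mulrn ?powR_ge0// /u -powRrM; congr powR.
by rewrite /r; field.
Qed.

Lemma powR_half_ge1 : 1 <= u.
Proof.
rewrite -[leLHS](powRr0 p) /u; apply: ler_powR => //.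
by apply: le_trans p2; rewrite ler1n.
Qed.

Lemma truncation_powR : (L `^ (r - 1))^-1 = L / u ^+ 4.
Proof.
have -> : u ^+ 4 = L `^ (r - 1) * L.
  rewrite mulrC mulr_powRB1 ?(ltW L0)//; last exact: lt_le_trans r1.
  by rewrite -(powR_mulrn 4 (powR_ge0 p r)) powRAC powR_mulrn// ltW.
by rewrite invfM mulrCA divff ?mulr1// gt_eqF.
Qed.

Lemma truncation_powR_half : (L `^ (r / 2 - 1))^-1 ^+ 2 = L ^+ 2 / u ^+ 4.
Proof.
have l0 : 0 < L `^ (r - 1) by exact: powR_gt0.
have -> : L ^+ 2 / u ^+ 4 = L * (L `^ (r - 1))^-1.
  by rewrite truncation_powR mulrA.
rewrite exprVn -powR_mulrn ?powR_ge0// -powRrM.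
have -> : (r / 2 - 1) * 2 = (r - 1) - 1 by field.
have -> : L `^ (r - 1) = L `^ (r - 1 - 1) * L.
  rewrite -[X in _ = _ * X](powRr1 (ltW L0)) -powRD ?subrK//.
  by rewrite (gt_eqF L0) implybT.
by rewrite invfM mulrCA divff ?mulr1// gt_eqF.
Qed.

(** The chaos coefficient contains moments of order [r / 2] and enters squared, so [sum_le_max] is
    used at exponent [r / 2]; Jensen's inequality brings the squared moment of the maximum back to
    order [r]. *)
Lemma half_row_sum_le : 2 <= r ->
  (\sum_i \int[P]_w (sqnorm i (X1 i w) `^ (r / 2))) ^+ 2 <=
  2 * (L ^+ 2 / u ^+ 4 * total_variance `^ r) + 2 * ((1 + L) ^+ 2 * max_row).
Proof.
move=> r2; have rh1 : 1 <= r / 2 by rewrite ler_pdivlMr// mul1r.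
have rh0 : 0 <= r / 2 by exact: le_trans rh1.
have := sum_le_max ind1 rh1 L0 bmf_sqnorm sqnorm_ge0.
set E := \sum_i _; set M := \int[P]_w _; rewrite -/total_variance.
have M0 : 0 <= M by apply: Rintegral_ge0 => w _; exact: powR_ge0.
have E0 : 0 <= E.
  by apply: sumr_ge0 => i _; apply: Rintegral_ge0 => w _; exact: powR_ge0.
have M2 : M ^+ 2 <= max_row.
  have bqX i := bmf_RV X1 i (bmf_sqnorm i).
  have b : bmf (fun w => (\big[Num.max/0]_i sqnorm i (X1 i w)) `^ (r / 2)).
    by apply: bmf_powR => //; exact: bmf_bigmax.
  rewrite -(powR_mulrn 2 M0); apply: le_trans (jensen_powR P _ b _) _.
  - by rewrite ler1n.
  - by move=> w; exact: powR_ge0.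
  rewrite /max_row le_eqVlt; apply/orP; left; apply/eqP.
  by apply: eq_Rintegral => w _; rewrite -powRrM divfK.
set a := (L `^ _)^-1; have a0 : 0 <= a by rewrite invr_ge0 powR_ge0.
set t := total_variance `^ (r / 2); have t0 : 0 <= t by exact: powR_ge0.
have L1 : 0 <= 1 + L by rewrite addr_ge0// ltW.
have tE : total_variance `^ r = t ^+ 2.
  by rewrite /t -powR_mulrn ?powR_ge0// -powRrM divfK.
move=> hE; apply: le_trans (_ : (a * t + (1 + L) * M) ^+ 2 <= _).
  by apply: lerXn2r; rewrite ?nnegrE// addr_ge0 ?mulr_ge0.
rewrite -truncation_powR_half -/a tE -exprMn.
apply: le_trans (_ : 2 * (a * t) ^+ 2 + 2 * ((1 + L) * M) ^+ 2 <= _).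
  by have := sqr_ge0 (a * t - (1 + L) * M); lra.
by rewrite lerD2l ler_wpM2l// exprMn ler_wpM2l ?sqr_ge0.
Qed.

Lemma chaos_coeff_sqr_le : u * chaos_coeff r ^+ 2 <=
  8 * (1 + L) ^+ 2 * (u * total_variance `^ r + u ^+ 2 * sigma `^ p + u ^+ 3 * max_row).
Proof.
have u1 := powR_half_ge1; have u0 : 0 < u by exact: lt_le_trans u1.
have mr0 : 0 <= total_variance `^ r by exact: powR_ge0.
have s0 : 0 <= sigma `^ p by exact: powR_ge0.
have Mx0 : 0 <= max_row by apply: Rintegral_ge0 => w _; exact: powR_ge0.
have l1 : 1 <= (1 + L) ^+ 2 by rewrite exprn_ege1// lerDl ltW.
have uk k : 0 <= u ^+ k by rewrite exprn_ge0// ltW.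
have us0 : 0 <= u ^+ 2 * sigma `^ p by rewrite mulr_ge0.
have uM0 : 0 <= u ^+ 3 * max_row by rewrite mulr_ge0.
have um0 : 0 <= u * total_variance `^ r by rewrite mulr_ge0// ltW.
rewrite /chaos_coeff; case: ifPn => [r2|_]; last first.
  have -> : (total_variance `^ (r / 2)) ^+ 2 = total_variance `^ r.
    by rewrite -powR_mulrn ?powR_ge0// -powRrM divfK.
  rewrite -[leLHS]mul1r; apply: ler_pM => //; lra.
set A := r `^ (r / 2) * _; set E := \sum_i _; set B := r `^ r * E.
have rp : r <= p by have := pgt0; rewrite /r; lra.
have rr : r `^ r <= u by apply: ge0_ler_powR; rewrite ?nnegrE ?(ltW pgt0).
have A2 : A ^+ 2 <= u * sigma `^ p.
  have -> : A ^+ 2 = r `^ r * sigma `^ p.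
    rewrite /A exprMn -!powR_mulrn ?powR_ge0// -!powRrM.
    by congr (_ `^ _ * _ `^ _); rewrite /r; field.
  by rewrite ler_wpM2r.
have B2 : B ^+ 2 <= u ^+ 2 * E ^+ 2.
  rewrite exprMn ler_wpM2r ?sqr_ge0//.
  by apply: lerXn2r => //; rewrite nnegrE powR_ge0.
have E2 := half_row_sum_le r2; rewrite -/E in E2.
have AB : (A + B) ^+ 2 <= 2 * A ^+ 2 + 2 * B ^+ 2.
  by have := sqr_ge0 (A - B); lra.
apply: le_trans (_ : u * (2 * (u * sigma `^ p) + 2 * (u ^+ 2 *
   (2 * (L ^+ 2 / u ^+ 4 * total_variance `^ r) + 2 * ((1 + L) ^+ 2 * max_row)))) <= _).
  rewrite ler_wpM2l ?(ltW u0)//; apply: le_trans AB _.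
  rewrite lerD// ler_wpM2l//; apply: le_trans B2 _.
  by rewrite ler_wpM2l.
have h1 : u ^+ 3 * (L ^+ 2 / u ^+ 4 * total_variance `^ r) <=
    (1 + L) ^+ 2 * (u * total_variance `^ r).
  have -> : u ^+ 3 * (L ^+ 2 / u ^+ 4 * total_variance `^ r) =
      L ^+ 2 * (u^-1 * total_variance `^ r) by field; rewrite gt_eqF.
  apply: ler_pM; rewrite ?sqr_ge0 ?mulr_ge0 ?invr_ge0 ?(ltW u0)//.
    by apply: lerXn2r; rewrite ?nnegrE ?addr_ge0 ?(ltW L0)// lerDr.
  rewrite ler_wpM2r// (le_trans _ u1)// invf_le1//.
have h2 : u ^+ 2 * sigma `^ p <= (1 + L) ^+ 2 * (u ^+ 2 * sigma `^ p).
  by rewrite ler_peMl.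
have h3 : 0 <= (1 + L) ^+ 2 * (u * total_variance `^ r) by rewrite mulr_ge0 ?sqr_ge0.
have h4 : 0 <= (1 + L) ^+ 2 * (u ^+ 3 * max_row) by rewrite mulr_ge0 ?sqr_ge0.
have h5 : 0 <= (1 + L) ^+ 2 * (u ^+ 2 * sigma `^ p) by rewrite mulr_ge0 ?sqr_ge0.
rewrite [leLHS](_ : _ = 2 * (u ^+ 2 * sigma `^ p) +
   4 * (u ^+ 3 * (L ^+ 2 / u ^+ 4 * total_variance `^ r)) +
   4 * ((1 + L) ^+ 2 * (u ^+ 3 * max_row))); last by ring.
move: h1 h2 h3 h4 h5.
move: (u ^+ 3 * (L ^+ 2 / u ^+ 4 * total_variance `^ r)) => q.
move: (u * total_variance `^ r) (u ^+ 2 * sigma `^ p) (u ^+ 3 * max_row).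
by move: ((1 + L) ^+ 2) => l a b c h1 h2 h3 h4 h5; lra.
Qed.

(** Rosenthal in the second family, for each first sample outside the null set where some [E_2 h_ij]
    is nonzero; the sum of the variances is then the full [sqnorm_sum]. *)
Lemma row_step : \int[P]_w \int[P]_w'
    (`|\sum_i \sum_j h i j (X1 i w, X2 j w')| `^ p) <=
  12 `^ p * (u * \int[P]_w (sqnorm_sum [set: 'I_n]%SET (X1 ^~ w) `^ r) +
    p `^ p * \sum_j \int[P]_w' \int[P]_w (`|\sum_i h i j (X1 i w, X2 j w')| `^ p)).
Proof.
have p0 := ltW pgt0.
have sliceE x j y : slice [set: 'I_n]%SET x j y = \sum_i h i j (x i, y).
  by apply: eq_bigl => i; rewrite inE.
have bh2 j : bmf (fun w => \int[P]_w' (`|\sum_i h i j (X1 i w, X2 j w')| `^ p)).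
  by kernel_tac.
have bQ : bmf (fun w => sqnorm_sum [set: 'I_n]%SET (X1 ^~ w) `^ r).
  apply: bmf_powR => //.
  apply: (bmf_comp (g := fun w => (X1 ^~ w) : fam 'I_n S)) (bmf_sqnorm_sum _).
  by apply: measurable_fam => k; exact: measurable_funP.
have bR : bmf (fun w => u * sqnorm_sum [set: 'I_n]%SET (X1 ^~ w) `^ r + p `^ p *
    \sum_j \int[P]_w' (`|\sum_i h i j (X1 i w, X2 j w')| `^ p)).
  apply: bmfD; first by apply: bmfM => //; exact: bmf_cst.
  by apply: bmfM; [exact: bmf_cst|exact: bmf_sum].
have -> : \sum_j \int[P]_w' \int[P]_w (`|\sum_i h i j (X1 i w, X2 j w')| `^ p) =
    \sum_j \int[P]_w \int[P]_w' (`|\sum_i h i j (X1 i w, X2 j w')| `^ p).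
  by apply: eq_bigr => j _; rewrite [LHS]Ex_swap//; kernel_tac.
rewrite -(Ex_sum P _ _ bh2) -(ExZ P u bQ) -(ExZ P (p `^ p) (bmf_sum _ _ bh2)).
rewrite -ExD; last 2 first.
- by apply: bmfM => //; exact: bmf_cst.
- by apply: bmfM; [exact: bmf_cst|exact: bmf_sum].
rewrite -(ExZ P (12 `^ p) bR); apply: le_Ex_ae.
- by kernel_tac.
- by apply: bmfM => //; exact: bmf_cst.
- by move=> w; apply: Rintegral_ge0 => w' _; exact: powR_ge0.
- move=> w; rewrite mulr_ge0 ?powR_ge0// addr_ge0 ?mulr_ge0 ?powR_ge0//.
  by apply: sumr_ge0 => j _; apply: Rintegral_ge0 => w' _; exact: powR_ge0.
have : {ae P, forall w i j, \int[P]_w' h i j (X1 i w, X2 j w') = 0}.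
  by apply: filter_forall => i; apply: filter_forall => j; exact: deg2.
apply: filterS => w d0.
have bpsi j : bmf (fun y => \sum_i h i j (X1 i w, y)) by kernel_tac.
have psi0 j : \int[P]_w' (\sum_i h i j (X1 i w, X2 j w')) = 0.
  by rewrite Ex_sum => [|i]; [rewrite big1|kernel_tac].
have H := rosenthalT ind2 p2 bpsi psi0.
have sqE : sqnorm_sum [set: 'I_n]%SET (X1 ^~ w) =
    \sum_j \int[P]_w' ((\sum_i h i j (X1 i w, X2 j w')) ^+ 2).
  apply: eq_bigr => j _; apply: eq_Rintegral => w' _.
  by rewrite sliceE.
rewrite sqE; apply: le_trans H.
by under eq_Rintegral do rewrite exchange_big.
Qed.

(** Rosenthal in the first family, column by column and for almost every value of [X2 j]; the sum of
    the variances is [cosqnorm j]. *)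
Lemma col_step : \sum_j \int[P]_w' \int[P]_w
     (`|\sum_i h i j (X1 i w, X2 j w')| `^ p) <=
  12 `^ p * (u * \sum_j \int[P]_w (cosqnorm j (X2 j w) `^ r) +
    p `^ p * \sum_j \sum_i \int[P]_w' \int[P]_w
     ((h i j (X1 i w, X2 j w') ^+ 2) `^ r)).
Proof.
have p0 := ltW pgt0.
rewrite !mulr_sumr -big_split/= mulr_sumr; apply: ler_sum => j _.
have bc : bmf (fun w' => cosqnorm j (X2 j w') `^ r).
  by apply: bmf_powR => //; exact: (bmf_RV X2 j (bmf_cosqnorm j)).
have bh2 i : bmf (fun w' => \int[P]_w ((h i j (X1 i w, X2 j w') ^+ 2) `^ r)).
  by kernel_tac.
have bR : bmf (fun w' => u * cosqnorm j (X2 j w') `^ r + p `^ p *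
    \sum_i \int[P]_w ((h i j (X1 i w, X2 j w') ^+ 2) `^ r)).
  apply: bmfD; first by apply: bmfM => //; exact: bmf_cst.
  by apply: bmfM; [exact: bmf_cst|exact: bmf_sum].
rewrite -(Ex_sum P _ _ bh2) -(ExZ P u bc) -(ExZ P (p `^ p) (bmf_sum _ _ bh2)).
rewrite -ExD; last 2 first.
- by apply: bmfM => //; exact: bmf_cst.
- by apply: bmfM; [exact: bmf_cst|exact: bmf_sum].
rewrite -(ExZ P (12 `^ p) bR); apply: le_Ex_ae.
- by kernel_tac.
- by apply: bmfM => //; exact: bmf_cst.
- by move=> w; apply: Rintegral_ge0 => w' _; exact: powR_ge0.
- move=> w; rewrite mulr_ge0 ?powR_ge0// addr_ge0 ?mulr_ge0 ?powR_ge0//.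
  by apply: sumr_ge0 => i _; apply: Rintegral_ge0 => w' _; exact: powR_ge0.
have : {ae P, forall w' i, \int[P]_w h i j (X1 i w, X2 j w') = 0}.
  by apply: filter_forall => i; exact: deg1.
apply: filterS => w' d0.
have bpsi i : bmf (fun s => h i j (s, X2 j w')) by kernel_tac.
have H := rosenthalT ind1 p2 bpsi d0.
have hE : \sum_i \int[P]_w (`|h i j (X1 i w, X2 j w')| `^ p) =
    \sum_i \int[P]_w ((h i j (X1 i w, X2 j w') ^+ 2) `^ r).
  apply: eq_bigr => i _; apply: eq_Rintegral => w _.
  rewrite -real_normK ?num_real// -(powR_mulrn 2)// -powRrM.
  by congr powR; rewrite /r; field.
by rewrite -hE.
Qed.

(** [p <= 2^p] by the tangent at 1, so [L <= 2^(4 p)]; the summand 1 costs one more factor [2^p]. *)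
Lemma truncation_le : 1 + L <= 32 `^ p.
Proof.
have p2p : p <= 2 `^ p.
  have p1 : 1 <= p by apply: le_trans p2; rewrite ler1n.
  have := powR_tangent p1 (@ler01 R) (ler0n R 2).
  by rewrite !powR1; lra.
have two0 : 0 <= 2 `^ p :> R by exact: powR_ge0.
have h4 : L <= (2 `^ p) ^+ 4 by apply: lerXn2r; rewrite // nnegrE ltW.
have two1 : 2 <= 2 `^ p :> R by exact: le_trans p2 p2p.
have -> : 32 `^ p = (2 `^ p) ^+ 5 :> R.
  have -> : (32 : R) = 2 `^ 5 by rewrite powR_mulrn//; ring.
  by rewrite -(powR_mulrn 5 two0) -!powRrM mulrC.
rewrite [X in _ <= X]exprS; have := exprn_ege1 4 (le_trans (ler1n R 2) two1).
have : 2 * (2 `^ p) ^+ 4 <= 2 `^ p * (2 `^ p) ^+ 4 by rewrite ler_wpM2r ?exprn_ge0.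
lra.
Qed.

(** In the constant, [12^2] pays for two uses of Rosenthal, 240 for the moments of [Q], [32^3] for
    [(1 + L)^3], and 5 for [17 <= 5^2 <= 5^p]. *)
Lemma decoupled_moment : \int[P]_w \int[P]_w'
    (`|\sum_i \sum_j h i j (X1 i w, X2 j w')| `^ p) <=
  (12 ^+ 2 * 240 * 32 ^+ 3 * 5) `^ p *
  (p `^ (p / 2) * total_variance `^ (p / 2) + p `^ p * sigma `^ p +
   p `^ (3 * p / 2) * (max_row + max_col) + p `^ (2 * p) * max_entry).
Proof.
have p0 := ltW pgt0; have u1 := powR_half_ge1.
have p1 : 1 <= p by apply: le_trans p2; rewrite ler1n.
have rp : r <= p by rewrite /r ler_pdivrMr// ler_peMr// ler1n.
have u2 : p `^ p = u ^+ 2 by rewrite -powR_half_mul; congr powR; field.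
have u3 : p `^ (3 * p / 2) = u ^+ 3 by rewrite -powR_half_mul.
have u4 : p `^ (2 * p) = u ^+ 4.
  by rewrite -powR_half_mul; congr powR; field.
have ge1 (a : R) q : 1 <= a -> 0 <= q -> 1 <= a `^ q.
  by move=> a1 q0; rewrite -[leLHS](powRr0 a); exact: ler_powR.
have E0 i : 0 <= \int[P]_w (sqnorm i (X1 i w) `^ r).
  by apply: Rintegral_ge0 => w _; exact: powR_ge0.
have F0 j : 0 <= \int[P]_w (cosqnorm j (X2 j w) `^ r).
  by apply: Rintegral_ge0 => w _; exact: powR_ge0.
have D1 := sqnorm_total_le.
have D2 := sqnorm_sum_moment_le [set: 'I_n]%SET r1.
have C1 := chaos_coeff_sqr_le.
have R1 := row_sum_le; have R2 := col_sum_le; have R3 := entry_sum_le.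
have S1 := row_step; have S2 := col_step.
rewrite truncation_powR in R1 R2 R3; rewrite u2 in S1 S2.
rewrite u2 u3 u4 -/r -/u.
have k16 : 16 `^ r <= 240 `^ p :> R.
  apply: le_trans (_ : 240 `^ r <= _).
    by apply: ge0_ler_powR; rewrite ?nnegrE ?ler0n ?ler_nat.
  by apply: ler_powR; rewrite ?ler1n.
have k4 : 2 * 2 `^ r * 16 `^ r <= 2 * 240 `^ p :> R.
  rewrite -mulrA ler_wpM2l// -powRM//.
  apply: le_trans (_ : 240 `^ r <= _).
    by apply: ge0_ler_powR; rewrite ?nnegrE ?mulr_ge0 ?ler0n// -natrM ler_nat.
  by apply: ler_powR; rewrite ?ler1n.
have kk : 240 `^ r ^+ 2 = 240 `^ p :> R.
  by rewrite -powR_mulrn ?powR_ge0// -powRrM /r divfK.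
have D3 : \int[P]_w ((\sum_i sqnorm i (X1 i w)) `^ r) <=
    16 `^ r * (total_variance `^ r + u * \sum_i \int[P]_w (sqnorm i (X1 i w) `^ r)).
  apply: le_trans D1 _; rewrite ler_wpM2l ?powR_ge0// lerD2l ler_wpM2r ?sumr_ge0//.
  by apply: ge0_ler_powR; rewrite ?nnegrE.
rewrite exprMn kk in D2.
have n0 (q : R) (f : T -> R) : 0 <= \int[P]_w (f w `^ q).
  by apply: Rintegral_ge0 => w _; exact: powR_ge0.
have Mh0 : 0 <= max_entry.
  by apply: Rintegral_ge0 => w _; exact: n0.
have main := moment_accounting u1 (ltW L0) (ge1 16 r _ r0) (ge1 240 p _ p0)
  (ge1 12 p _ p0) _ k16 k4 (powR_ge0 _ _) (powR_ge0 sigma p) (n0 _ _) (n0 _ _) Mh0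
  (sumr_ge0 _ (fun i _ => E0 i)) (sumr_ge0 _ (fun j _ => F0 j))
  R1 R2 D3 D2 C1 R3 S2 S1.
apply: le_trans (main _ _ _ _) _; rewrite ?ler1n ?mulr_ge0 ?powR_ge0//.
rewrite ler_wpM2r//.
  by rewrite !addr_ge0 ?mulr_ge0 ?exprn_ge0 ?powR_ge0 ?addr_ge0 ?n0.
have l0 : 0 <= 1 + L by rewrite addr_ge0// ltW.
have five : 17 <= 5 `^ p :> R.
  apply: le_trans (_ : 5 `^ 2 <= _); last by apply: ler_powR; rewrite ?ler1n.
  by rewrite powR_mulrn// -natrX ler_nat.
have powE (a b c e : R) : 0 <= a -> 0 <= b -> 0 <= c -> 0 <= e ->
    (a ^+ 2 * b * c ^+ 3 * e) `^ p = (a `^ p) ^+ 2 * b `^ p * (c `^ p) ^+ 3 * e `^ p.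
  by move=> a0 b0 c0 e0; rewrite !powRM ?mulr_ge0 ?exprn_ge0// !powRX.
rewrite powE ?ler0n//; apply: ler_pM => //.
  by rewrite !mulr_ge0 ?exprn_ge0 ?powR_ge0.
rewrite ler_wpM2l ?mulr_ge0 ?exprn_ge0 ?powR_ge0//.
apply: lerXn2r; rewrite ?nnegrE ?powR_ge0//; exact: truncation_le.
Qed.

End decoupled.

(** * From iterated real integrals to the extended real statement *)

Lemma EFin_bigmax {R : realType} {I : finType} (F : I -> R) :
  \big[maxe/0%E]_i (F i)%:E = (\big[Num.max/0]_i F i)%:E.
Proof. by rewrite (big_morph EFin (id1 := 0%E) (op1 := maxe))// => x y; rewrite EFin_max. Qed.

Lemma powR_bigmax_le {R : realType} {I : finType} (F : I -> R) (r : R) :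
  0 < r -> (forall i, 0 <= F i) ->
  (\big[Num.max/0]_i F i) `^ r <= \big[Num.max/0]_i (F i `^ r).
Proof.
move=> r0 F0; elim/big_ind2: _ => [|x1 x2 y1 y2 h1 h2|i _]; last by [].
  by rewrite powR0 ?gt_eqF.
by rewrite le_max; case: (leP x2 y2) => _; rewrite ?h1 ?h2 ?orbT.
Qed.

Section joint_family.
Context {d d'} {T : measurableType d} {S : measurableType d'} {R : realType}.
Context {P : probability T R} {n : nat} (X1 X2 : 'I_n -> {RV P >-> S}).
Hypothesis ind : mutually_independent (join_family X1 X2).

Lemma mutually_independent_inl : mutually_independent X1.
Proof.
move=> J A mA.
pose A' (k : 'I_n + 'I_n) := match k with inl i => A i | inr _ => setT end.
have mA' k : measurable (A' k) by case: k => i; [exact: mA|exact: measurableT].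
have := @ind (inl @: J)%SET A' mA'.
rewrite big_imset/=; last by move=> i j _ _ [].
move=> <-; congr (P _); apply/seteqP; split=> w /= wA.
  by move=> _ /= /imsetP[i iJ ->]; exact: wA.
by move=> i /= iJ; apply: (wA (inl i)) => /=; exact: imset_f.
Qed.

Lemma mutually_independent_inr : mutually_independent X2.
Proof.
move=> J A mA.
pose A' (k : 'I_n + 'I_n) := match k with inr i => A i | inl _ => setT end.
have mA' k : measurable (A' k) by case: k => i; [exact: measurableT|exact: mA].
have := @ind (inr @: J)%SET A' mA'.
rewrite big_imset/=; last by move=> i j _ _ [].
move=> <-; congr (P _); apply/seteqP; split=> w /= wA.
  by move=> _ /= /imsetP[i iJ ->]; exact: wA.
by move=> i /= iJ; apply: (wA (inr i)) => /=; exact: imset_f.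
Qed.

(** Resampling the whole second family identifies [E] with the iterated expectation [E_1 E_2]. *)
Lemma Ex_decouple (G : ('I_n -> S) -> ('I_n -> S) -> R) :
  bmf (fun x : fam ('I_n + 'I_n)%type S => G (fun i => x (inl i)) (fun j => x (inr j))) ->
  \int[P]_w G (X1 ^~ w) (X2 ^~ w) = \int[P]_w \int[P]_w' G (X1 ^~ w) (X2 ^~ w').
Proof.
move=> bG; have := resample ind [set k | if k is inl _ then true else false]%SET bG.
rewrite /= => ->; apply: eq_Rintegral => w _; apply: eq_Rintegral => w' _.
by congr G; apply/funext => i; rewrite /mix inE.
Qed.

End joint_family.

(* Maxima of nonnegative quantities are taken with default value 0, which only
   matters for n = 0. *)
Theorem theorem3p2 (R : realType) :
  exists K : R, 0 < K /\
  forall (d d' : measure_display) (T : measurableType d) (S : measurableType d')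
    (P : probability T R) (n : nat) (X1 X2 : 'I_n -> {RV P >-> S})
    (h : 'I_n -> 'I_n -> S * S -> R),
    mutually_independent (join_family X1 X2) ->
    (forall i j, measurable_fun setT (h i j)) ->
    (forall i j, exists M : R, forall z, `|h i j z| <= M) ->
    canonical_kernels X1 X2 h ->
    forall p : R, 2 <= p ->
    ('E_P[(fun w => `|\sum_(i < n) \sum_(j < n) h i j (X1 i w, X2 j w)| `^ p)%R]
     <= (K `^ p)%:E *
        ((p `^ (p / 2))%:E *
           (\sum_(i < n) \sum_(j < n)
              'E_P[(fun w => h i j (X1 i w, X2 j w) ^+ 2)%R]) `^ (p / 2)
         + (p `^ p)%:E * (opnorm X1 X2 h) `^ p
         + (p `^ (3 * p / 2))%:E *
           (partial_expectation X1 (fun x => \big[maxe/0]_(i < n)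
              (\sum_(j < n) partial_expectation X2 (fun y =>
                 (h i j (x i, y j) ^+ 2)%:E)) `^ (p / 2))
            + partial_expectation X2 (fun y => \big[maxe/0]_(j < n)
              (\sum_(i < n) partial_expectation X1 (fun x =>
                 (h i j (x i, y j) ^+ 2)%:E)) `^ (p / 2)))
         + (p `^ (2 * p))%:E *
           'E_P[(fun w => \big[Num.max/0]_(i < n) \big[Num.max/0]_(j < n)
                  `|h i j (X1 i w, X2 j w)| `^ p)%R]))%E.
Proof.
pose K : R := 12 ^+ 2 * 240 * 32 ^+ 3 * 5.
have K0 : 0 < K by rewrite !mulr_gt0 ?exprn_gt0 ?ltr0n.
exists K; split=> // d d' T S P n X1 X2 h ind mh hM can p p2.
have bh i j : bmf (h i j) by split.
have ind1 := mutually_independent_inl ind.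
have ind2 := mutually_independent_inr ind.
have p0 : 0 < p by exact: lt_le_trans p2.
have r0 : 0 < p / 2 by rewrite divr_gt0.
have bk1 i j w : bmf (fun w' => h i j (X1 i w', X2 j w)).
  by apply: (bmf_kernel bh); measurable_tac.
have bk2 i j w : bmf (fun w' => h i j (X1 i w, X2 j w')).
  by apply: (bmf_kernel bh); measurable_tac.
have bk i j : bmf (fun w => h i j (X1 i w, X2 j w)).
  by apply: (bmf_kernel bh); measurable_tac.
have bx i j : bmf (fun x : fam ('I_n + 'I_n)%type S => h i j (x (inl i), x (inr j))).
  by apply: (bmf_kernel bh); measurable_tac.
have deg1 i j : {ae P, forall w, \int[P]_w' h i j (X1 i w', X2 j w) = 0}.
  by have [+ _] := can i j; apply: filterS => w; rewrite /partial_expectation /Rintegral => ->.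
have deg2 i j : {ae P, forall w, \int[P]_w' h i j (X1 i w, X2 j w') = 0}.
  by have [_ +] := can i j; apply: filterS => w; rewrite /partial_expectation /Rintegral => ->.
have bS : bmf (fun w => `|\sum_i \sum_j h i j (X1 i w, X2 j w)| `^ p).
  by apply: bmf_powR (ltW p0) _; bmf_tac.
have lhsE : ('E_P[(fun w => `|\sum_(i < n) \sum_(j < n) h i j (X1 i w, X2 j w)| `^ p)%R]
    = (\int[P]_w \int[P]_w' (`|\sum_i \sum_j h i j (X1 i w, X2 j w')| `^ p))%:E)%E.
  rewrite expectation.unlock EFin_Rintegral//; congr EFin.
  apply: (Ex_decouple ind (G := fun x y => `|\sum_i \sum_j h i j (x i, y j)| `^ p)).
  by apply: bmf_powR (ltW p0) _; bmf_tac.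
have varE : (\sum_(i < n) \sum_(j < n) 'E_P[(fun w => h i j (X1 i w, X2 j w) ^+ 2)%R]
    = (total_variance X1 X2 h)%:E)%E.
  rewrite /total_variance /sqnorm -sumEFin; apply: eq_bigr => i _.
  rewrite Ex_sum => [|j]; last first.
    by bmf_tac; apply: (bmf_kernel bh); measurable_tac.
  rewrite -sumEFin; apply: eq_bigr => j _.
  rewrite expectation.unlock EFin_Rintegral; last exact: bmfX.
  congr EFin.
  apply: (Ex_decouple ind (G := fun x y => h i j (x i, y j) ^+ 2)).
  exact: bmfX.
have rowE : ((max_row X1 X2 h p)%:E <= partial_expectation X1 (fun x =>
    \big[maxe/0]_(i < n) (\sum_(j < n) partial_expectation X2 (fun y =>
      (h i j (x i, y j) ^+ 2)%:E)) `^ (p / 2)))%E.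
  rewrite /partial_expectation.
  have bq i : bmf (fun w => sqnorm X2 h i (X1 i w)) := bmf_RV X1 i (bmf_sqnorm X2 bh i).
  rewrite (_ : (fun w => _) = fun w =>
      (\big[Num.max/0]_i (sqnorm X2 h i (X1 i w) `^ (p / 2)))%:E); last first.
    apply/funext => w; rewrite -EFin_bigmax; apply: eq_bigr => i _.
    rewrite -poweR_EFin /sqnorm -sumEFin; congr poweR; apply: eq_bigr => j _.
    by rewrite EFin_Rintegral//; exact: bmfX.
  rewrite EFin_Rintegral ?lee_fin; last first.
    by apply: bmf_bigmax => i; exact: bmf_powR (ltW r0) _.
  apply: le_Ex => [||w].
  - by apply: bmf_powR (ltW r0) _; exact: bmf_bigmax.
  - by apply: bmf_bigmax => i; exact: bmf_powR (ltW r0) _.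
  - by apply: powR_bigmax_le => // i; exact: sqnorm_ge0.
have colE : ((max_col X1 X2 h p)%:E <= partial_expectation X2 (fun y =>
    \big[maxe/0]_(j < n) (\sum_(i < n) partial_expectation X1 (fun x =>
      (h i j (x i, y j) ^+ 2)%:E)) `^ (p / 2)))%E.
  rewrite /partial_expectation.
  have bq j : bmf (fun w => cosqnorm X1 h j (X2 j w)) := bmf_RV X2 j (bmf_cosqnorm X1 bh j).
  rewrite (_ : (fun w => _) = fun w =>
      (\big[Num.max/0]_j (cosqnorm X1 h j (X2 j w) `^ (p / 2)))%:E); last first.
    apply/funext => w; rewrite -EFin_bigmax; apply: eq_bigr => j _.
    rewrite -poweR_EFin /cosqnorm -sumEFin; congr poweR; apply: eq_bigr => i _.
    by rewrite EFin_Rintegral//; exact: bmfX.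
  rewrite EFin_Rintegral ?lee_fin; last first.
    by apply: bmf_bigmax => j; exact: bmf_powR (ltW r0) _.
  apply: le_Ex => [||w].
  - by apply: bmf_powR (ltW r0) _; exact: bmf_bigmax.
  - by apply: bmf_bigmax => j; exact: bmf_powR (ltW r0) _.
  - by apply: powR_bigmax_le => // j; exact: cosqnorm_ge0.
have entryE : ((max_entry X1 X2 h p)%:E <=
    'E_P[(fun w => \big[Num.max/0]_(i < n) \big[Num.max/0]_(j < n)
                  `|h i j (X1 i w, X2 j w)| `^ p)%R])%E.
  rewrite expectation.unlock EFin_Rintegral; last first.
    by apply: bmf_bigmax => i; apply: bmf_bigmax => j; apply: bmf_powR (ltW p0) _; bmf_tac.
  have bm2 : bmf (fun w => (\big[Num.max/0]_j \big[Num.max/0]_i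
      h i j (X1 i w, X2 j w) ^+ 2) `^ (p / 2)).
    by apply: bmf_powR (ltW r0) _; bmf_tac.
  rewrite lee_fin /max_entry -(Ex_decouple ind (G := fun x y =>
    (\big[Num.max/0]_j \big[Num.max/0]_i h i j (x i, y j) ^+ 2) `^ (p / 2))); last first.
    by apply: bmf_powR (ltW r0) _; bmf_tac.
  apply: le_Ex => // [|w].
    by apply: bmf_bigmax => i; apply: bmf_bigmax => j; apply: bmf_powR (ltW p0) _; bmf_tac.
  apply: le_trans (powR_bigmax_le r0 _) _ => [j|]; first exact: bigmax_ge_id.
  apply: bigmax_le => [|j _]; first exact: bigmax_ge_id.
  apply: le_trans (powR_bigmax_le r0 _) _ => [i|]; first exact: sqr_ge0.
  apply: bigmax_le => [|i _]; first exact: bigmax_ge_id.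
  have -> : (h i j (X1 i w, X2 j w) ^+ 2) `^ (p / 2) = `|h i j (X1 i w, X2 j w)| `^ p.
    rewrite -real_normK ?num_real// -(powR_mulrn 2)// -powRrM.
    by congr powR; field.
  by apply: (bigmax_sup i) => //; exact: (bigmax_sup j).
have op_ge0 : (0 <= opnorm X1 X2 h)%E.
  apply: ereal_sup_ubound; exists (fun _ _ => 0), (fun _ _ => 0); split.
  - by split=> ?; exact: measurable_cst.
  - rewrite expectation.unlock integral0_eq// => w _; rewrite big1// => i _.
    by rewrite expr0n.
  - rewrite expectation.unlock integral0_eq// => w _; rewrite big1// => i _.
    by rewrite expr0n.
  - rewrite expectation.unlock integral0_eq// => w _; rewrite big1// => i _.
    by rewrite big1// => j _; rewrite mulr0.
have n0 (Y : T -> R) q : 0 <= \int[P]_w (Y w `^ q).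
  by apply: Rintegral_ge0 => w _; exact: powR_ge0.
have row0 : 0 <= max_row X1 X2 h p by exact: n0.
have col0 : 0 <= max_col X1 X2 h p by exact: n0.
have entry0 : 0 <= max_entry X1 X2 h p.
  by apply: Rintegral_ge0 => w _; exact: n0.
have dm sigma (s0 : 0 <= sigma) op := decoupled_moment ind1 ind2 bh deg1 deg2 s0 op p2.
rewrite lhsE varE.
set Mx := partial_expectation X1 _ in rowE *; clearbody Mx.
set My := partial_expectation X2 _ in colE *; clearbody My.
set Mh := ('E_P[_])%E in entryE *; clearbody Mh.
set mx := max_row X1 X2 h p in rowE row0 dm; clearbody mx.
set my := max_col X1 X2 h p in colE col0 dm; clearbody my.
set me := max_entry X1 X2 h p in entryE entry0 dm; clearbody me.
have Mx0 : (0 <= Mx)%E by apply: le_trans rowE; rewrite lee_fin.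
have My0 : (0 <= My)%E by apply: le_trans colE; rewrite lee_fin.
have Mh0 : (0 <= Mh)%E by apply: le_trans entryE; rewrite lee_fin.
have pw0 (a b : R) : (0 <= (a `^ b)%:E)%E by rewrite lee_fin powR_ge0.
(* An infinite operator norm makes the right-hand side infinite, its other terms being nonnegative;
   otherwise [sigma] is its real value. *)
have [opy|opNy] := eqVneq (opnorm X1 X2 h) +oo%E.
  rewrite opy poweRyr ?gt_eqF// gt0_muley ?lte_fin ?powR_gt0//.
  rewrite -!addeA addye; last first.
    by rewrite gt_eqF// (lt_le_trans (ltNyr 0))// adde_ge0 ?mule_ge0 ?adde_ge0.
  rewrite addey; last by rewrite poweR_EFin -EFinM.
  by rewrite gt0_muley ?lte_fin ?powR_gt0// leey.
have opfin : opnorm X1 X2 h \is a fin_num by rewrite ge0_fin_numE// ltey.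
set sigma := fine (opnorm X1 X2 h).
have opE : opnorm X1 X2 h = sigma%:E by rewrite fineK.
have sigma0 : 0 <= sigma by rewrite fine_ge0.
(* Bounded test functions are admissible in the supremum, and [Ex_decouple] turns its single
   expectation into an iterated one. *)
have op_le (f g : 'I_n -> S -> R) :
    (forall i, bmf (f i)) -> (forall j, bmf (g j)) ->
    \sum_i \int[P]_w (f i (X1 i w) ^+ 2) <= 1 ->
    \sum_j \int[P]_w (g j (X2 j w) ^+ 2) <= 1 ->
    \int[P]_w \int[P]_w' (\sum_i \sum_j
      h i j (X1 i w, X2 j w') * f i (X1 i w) * g j (X2 j w')) <= sigma.
  move=> bf bg f1 g1; rewrite -lee_fin -opE.
  have bfX i := bmf_RV X1 i (bf i); have bgX j := bmf_RV X2 j (bg j).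
  rewrite -(Ex_decouple ind (G := fun x y => \sum_i \sum_j
    h i j (x i, y j) * f i (x i) * g j (y j))); last first.
    apply: bmf_sum => i; apply: bmf_sum => j; apply: bmfM; last exact: bmf_coord.
    by apply: bmfM; [exact: bx|exact: bmf_coord].
  apply: ereal_sup_ubound; exists f, g; split.
  - by split=> k; [have [] := bf k|have [] := bg k].
  - by rewrite expectation.unlock EFin_Rintegral ?lee_fin ?Ex_sum//; try move=> ?; bmf_tac.
  - by rewrite expectation.unlock EFin_Rintegral ?lee_fin ?Ex_sum//; try move=> ?; bmf_tac.
  - by rewrite expectation.unlock EFin_Rintegral//; bmf_tac.
rewrite opE !poweR_EFin.
have := dm sigma sigma0 op_le.
rewrite -lee_fin -/K => /le_trans; apply.
rewrite !EFinM !EFinD !EFinM lee_wpmul2l//.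
apply: leeD; last by apply: lee_wpmul2l.
apply: leeD => //; apply: lee_wpmul2l => //; rewrite EFinD; exact: leeD.
Qed.
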